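(* Let $k,m\ge 2$ and $n\ge 1$ be integers. Let $X$ be an $m$-colored set of $kn$ points in general position in $\mathbb{R}^2$. Suppose that $X$ admits a partition into $n$ pairwise disjoint $2$-colorful $k$-tuples (that is, $k$-element subsets). Then $X$ spans $n$ pairwise disjoint $2$-colorful $k$-islands.
   Context: A finite set in $\mathbb{R}^d$ is in general position if each of its subsets of size at most $d+1$ is affinely independent. A partition of a finite set $X$ into $m$ parts is called an $m$-coloring of $X$; the parts are called color classes, and $X$ is then called $m$-colored (color classes are allowed to be empty). A subset $Y\subseteq X$ is $j$-colorful if $Y$ contains points from at least $j$ distinct color classes. For a finite set $X\subset\mathbb{R}^d$ and $Y\subseteq X$, the convex hull $\operatorname{conv} Y$ is called an island spanned by $X$ if $X\cap \operatorname{conv} Y = Y$. It is called a $k$-island if in addition $|Y|=k$, and it is called $j$-colorful if $Y$ is $j$-colorful. Islands are pairwise disjoint if they (that is, the convex hulls) are pairwise disjoint as subsets of $\mathbb{R}^d$. *)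

(* Defs.v *)
From mathcomp Require Import all_boot all_order all_algebra finmap.
From mathcomp Require Import all_classical all_reals convex.

Set Implicit Arguments.
Unset Strict Implicit.
Unset Printing Implicit Defensive.

Import Order.TTheory GRing.Theory Num.Theory.
Local Open Scope ring_scope.

Section Islands.
Variables (R : realType) (d : nat).
Local Notation point := 'rV[R]_d.
Implicit Types X Y : {fset point}.

Definition affinely_independent Y :=
  forall w : point -> R,
    \sum_(y <- Y) w y = 0 -> \sum_(y <- Y) w y *: y = 0 ->
    forall y, y \in Y -> w y = 0.

Definition general_position X :=
  forall Y, (Y `<=` X)%fset -> (#|` Y|%fset <= d.+1)%N -> affinely_independent Y.

(* An indexed partition: the parts may be empty. *)
Definition partitions (m : nat) (P : 'I_m -> {fset point}) X :=
  (forall i j : 'I_m, i != j -> [disjoint P i & P j]%fset) /\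
  X = (\bigcup_(i in 'I_m) P i)%fset.

Definition colorful (m : nat) (C : 'I_m -> {fset point}) (j : nat) Y :=
  (j <= #|[set i : 'I_m | (C i `&` Y)%fset != fset0]%SET|)%N.

Definition convex_hull Y : set point :=
  smallest (@convex_set R point) [set` Y]%classic.

(* The island is the set [convex_hull Y]; the predicate is on [Y], which the island
   determines. *)
Definition island X Y :=
  (Y `<=` X)%fset /\ ([set` X] `&` convex_hull Y = [set` Y])%classic.

Definition kisland (k : nat) X Y := island X Y /\ #|` Y|%fset = k.

End Islands.

(* Main.v *)
(** Counting points of one colour in the given tuples shows that every colour class has at
    most [(k - 1) n] points, and only this is used.  For [k >= 3] the classes can be merged
    into two colours, each with at least [n] points, and one inducts on [n] by cutting the
    set with lines.  As a line turns, the set of [k i] points that it cuts off changes by one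
    exchange at a time, so all intermediate numbers of minority points occur.  If no line
    works, then [n = 2 h + 1] and every line that cuts off [k i <= k h] points leaves fewer
    than [i] minority points on that side.  One then uses fans of three rays, one of them
    pointing downwards.  An apex determines a left part [A], a right part [B] and an upper
    part [C] of sizes [k h], [k h], [k]; label it by a part with a surplus of minority
    points.  When a part becomes a half-plane it has a deficit, which is the boundary
    condition of Sperner's lemma; at a limit of rainbow cells the numbers of minority points
    in [A] and in [B] take at most two consecutive values each, so one of the tied fans has
    exactly the prescribed numbers.
    For [k = 2] merging may fail; then all classes have fewer than [n] points, and either a
    line cuts off two points of different colours or a sweep in a fixed direction finds a
    line on both sides of which no colour has a majority. *)

From mathcomp Require Import all_boot all_order all_algebra.
From mathcomp Require Import reals.
From mathcomp Require boolp classical_sets set_interval topology normedtype.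
From mathcomp Require Import zify ring lra.

Set Implicit Arguments.
Unset Strict Implicit.
Unset Printing Implicit Defensive.

Import Order.TTheory GRing.Theory Num.Theory.
Local Open Scope ring_scope.

(** * Sperner's lemma in a square *)

Section Lebesgue.
Import boolp classical_sets set_interval topology normedtype numFieldNormedType.Exports.
Variable R : realType.

(** With [P p] read as a neighbourhood of [p], [d] is a Lebesgue number of this cover of the square.
    It comes from compactness in its near-covering form, with [d] tending to 0 from the right. *)
Lemma lebesgue_number_square (P : R * R -> R * R -> Prop) (M : R) :
  (forall p, exists2 e, 0 < e &
     forall q, `|q.1 - p.1| < e -> `|q.2 - p.2| < e -> P p q) ->
  exists2 d, 0 < d & forall q, `|q.1| <= M -> `|q.2| <= M ->
    exists p, forall q', `|q'.1 - q.1| < d -> `|q'.2 - q.2| < d -> P p q'.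
Proof.
move=> locP; pose I := `[- M, M]%classic; pose K := (I `*` I)%classic.
have cK : compact K by apply: compact_setX; apply: segment_compact.
have /compact_near_coveringP ncK := cK.
pose Q (d : R) (q : R * R) := exists p, forall q',
  `|q'.1 - q.1| < d -> `|q'.2 - q.2| < d -> P p q'.
have [|d /= d0 Hd] := ncK R (0^'+)%classic Q _.
- move=> p _; have [e e0 He] := locP p.
  exists (ball p (e / 2), [set d | d < e / 2])%classic => /=.
    split; first by apply: nbhsx_ballx; rewrite divr_gt0.
    by apply: nbhs_right_lt; rewrite divr_gt0.
  move=> [q d] /= [[q1 q2] de]; exists p => q' h1 h2.
  move: q1 q2; rewrite /ball /= => q1 q2.
  apply: He.
  - have -> : q'.1 - p.1 = (q'.1 - q.1) - (p.1 - q.1) by ring.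
    by apply: (le_lt_trans (ler_normB _ _)); lra.
  - have -> : q'.2 - p.2 = (q'.2 - q.2) - (p.2 - q.2) by ring.
    by apply: (le_lt_trans (ler_normB _ _)); lra.
- exists (d / 2); first by rewrite divr_gt0.
  move=> q q1 q2.
  have /(_ q) : (K `<=` Q (d / 2))%classic.
    apply: Hd; rewrite /= ?divr_gt0 //.
    by rewrite sub0r normrN gtr0_norm ?divr_gt0 //; lra.
  by apply; split; rewrite /I /= in_itv /= -ler_norml.
Qed.
End Lebesgue.

Definition label := option bool.
Definition lA : label := Some true.
Definition lB : label := Some false.
Definition lC : label := None.

Section Grid.
Variable f : nat -> nat -> label.

Definition ab_edge (u v : label) : bool :=
  (u == lA) && (v == lB) || (u == lB) && (v == lA).

Definition rainbow (i j : nat) : Prop :=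
  forall l, exists a b : bool, f (i + a) (j + b) = l.

(** Around a cell without C the label switches between A and B an even number of times; without A or
    without B it has no A-B edge at all. An odd count therefore needs all three labels. *)
Lemma odd_ab_cell (u v w z : label) :
  ab_edge u v (+) ab_edge w z (+) (ab_edge u w (+) ab_edge v z) ->
  forall l, l \in [:: u; v; w; z].
Proof. by case: u => [[]|]; case: v => [[]|]; case: w => [[]|]; case: z => [[]|] // _ [[]|]. Qed.

Lemma rainbowE i j :
  (forall l, l \in [:: f i j; f i.+1 j; f i j.+1; f i.+1 j.+1]) -> rainbow i j.
Proof.
move=> H l; move: (H l); rewrite !inE => /or4P[] /eqP ->.
- by exists false, false; rewrite !addn0.
- by exists true, false; rewrite addn0 addn1.
- by exists false, true; rewrite addn0 addn1.
- by exists true, true; rewrite !addn1.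
Qed.

Definition row_parity (n j : nat) : bool :=
  \big[addb/false]_(i < n) ab_edge (f i j) (f i.+1 j).

(** Summed over a strip of cells, each with an even number of A-B edges, the inner vertical edges
    cancel in pairs. *)
Lemma row_parity_step n j :
  (forall i, (i < n)%N -> ~ rainbow i j) ->
  row_parity n j (+) row_parity n j.+1 =
  ab_edge (f 0 j) (f 0 j.+1) (+) ab_edge (f n j) (f n j.+1).
Proof.
elim: n => [|n IH] H; first by rewrite /row_parity !big_ord0 !addbb.
rewrite /row_parity !big_ord_recr /= -!/(row_parity _ _).
have := IH (fun i Hi => H i (ltnW Hi)).
have : ~~ (ab_edge (f n j) (f n.+1 j) (+) ab_edge (f n j.+1) (f n.+1 j.+1)
          (+) (ab_edge (f n j) (f n j.+1) (+) ab_edge (f n.+1 j) (f n.+1 j.+1))).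
  by apply/negP => /odd_ab_cell /rainbowE; apply: H.
move: (ab_edge (f n j) (f n.+1 j)) (ab_edge (f n j.+1) (f n.+1 j.+1)) (ab_edge (f n j) (f n j.+1)).
move: (ab_edge (f n.+1 j) (f n.+1 j.+1)) (ab_edge (f 0 j) _) (row_parity n j) (row_parity n j.+1).
by do 7!case.
Qed.

Lemma row_parity_noC n j :
  (forall i, (i <= n)%N -> f i j <> lC) -> row_parity n j = (f 0 j != f n j).
Proof.
elim: n => [|n IH] H; first by rewrite /row_parity big_ord0 eqxx.
rewrite /row_parity big_ord_recr /= -/(row_parity _ _) IH; last first.
  by move=> i Hi; apply: H; apply: leqW.
move: (H 0 isT) (H n (leqnSn n)) (H n.+1 (leqnn _)).
by case: (f 0 j) => [[]|] //; case: (f n j) => [[]|] //; case: (f n.+1 j) => [[]|].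
Qed.

(** Without a rainbow cell the parity of A-B edges is the same in all rows, because the two side
    columns are constant. It is even at the bottom, and odd at the top, which runs from B to A
    without C. *)
Lemma sperner_grid n :
  (forall j, (j <= n)%N -> f 0 j = lB) -> (forall j, (j <= n)%N -> f n j = lA) ->
  (forall i, (i <= n)%N -> f i n <> lC) ->
  (forall i, (i < n)%N -> ~~ ab_edge (f i 0) (f i.+1 0)) ->
  exists i j, [/\ (i < n)%N, (j < n)%N & rainbow i j].
Proof.
move=> hl hr ht hb; apply: boolp.contrapT => H.
have par j : (j <= n)%N -> row_parity n j = false.
  elim: j => [|j IH] jn.
    by rewrite /row_parity big1 // => i _; apply/negbTE/hb.
  have := @row_parity_step n j; rewrite !IH ?(ltnW jn) // hl ?hr // ?hl ?hr // ?(ltnW jn) //.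
  by rewrite addFb => -> // i Hi rb; apply: H; exists i, j.
have := par n (leqnn n).
by rewrite row_parity_noC // hl // hr.
Qed.

End Grid.

Section Sperner.
Variable R : realType.

(** The grid is finer than the Lebesgue number, so a rainbow cell lies in a single neighbourhood
    [P p]. Choosing its centre [p] replaces a limit of shrinking rainbow cells. *)
Lemma sperner_square (P : R * R -> R * R -> Prop) (lam : R * R -> label) (M : R) :
  0 < M ->
  (forall p, exists2 e, 0 < e &
     forall q, `|q.1 - p.1| < e -> `|q.2 - p.2| < e -> P p q) ->
  (forall y, lam (- M, y) = lB) -> (forall y, lam (M, y) = lA) ->
  (forall x, lam (x, M) <> lC) ->
  (forall p x x', P p (x, - M) -> P p (x', - M) ->
     lam (x, - M) = lA -> lam (x', - M) = lB -> False) ->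
  exists p, forall l, exists2 q, P p q & lam q = l.
Proof.
move=> M0 locP hl hr ht hb.
have [d d0 Hd] := lebesgue_number_square M locP.
pose n := (Num.truncn (2 * M / d)).+1.
have n0 : 0 < n%:R :> R by rewrite ltr0n.
pose h := 2 * M / n%:R.
have h0 : 0 < h by rewrite /h divr_gt0 // mulr_gt0.
have hd : h < d.
  rewrite /h ltr_pdivrMr // [d * _]mulrC -ltr_pdivrMr //.
  exact: truncnS_gt.
pose g (i : nat) := - M + h * i%:R.
have g0 : g 0 = - M by rewrite /g mulr0 addr0.
have gn : g n = M by rewrite /g /h divfK ?gt_eqF //; lra.
have gb i : (i <= n)%N -> `|g i| <= M.
  move=> lein; have : i%:R <= n%:R :> R by rewrite ler_nat.
  rewrite -(ler_pM2l h0) => H; have := gn; rewrite /g ler_norml => H2.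
  have : 0 <= h * i%:R by rewrite mulr_ge0 // ltW.
  lra.
have gd i (a : bool) : `|g (i + a)%N - g i| < d.
  rewrite /g natrD; case: a => /=; last by rewrite addr0 subrr normr0.
  have -> : - M + h * (i%:R + 1) - (- M + h * i%:R) = h by ring.
  by rewrite gtr0_norm.
have cell i j : (i < n)%N -> (j < n)%N -> exists p, forall a b : bool,
    P p (g (i + a)%N, g (j + b)%N).
  move=> Hi Hj; have [||p Hp] := Hd (g i, g j).
  - exact/gb/ltnW.
  - exact/gb/ltnW.
  by exists p => a b; apply: Hp; apply: gd.
have [||||i [j [Hi Hj rb]]] := @sperner_grid (fun i j => lam (g i, g j)) n.
- by move=> j _; rewrite g0.
- by move=> j _; rewrite gn.
- by move=> i _; rewrite gn.
- move=> i Hi; rewrite g0; apply/negP => /orP[] /andP[/eqP h1 /eqP h2].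
  + have [p Hp] := cell i 0%N Hi isT.
    have := Hp true false; have := Hp false false.
    by rewrite /= addn1 !addn0 g0 => H1 H2; apply: hb H1 H2 h1 h2.
  + have [p Hp] := cell i 0%N Hi isT.
    have := Hp true false; have := Hp false false.
    by rewrite /= addn1 !addn0 g0 => H1 H2; apply: hb H2 H1 h2 h1.
have [p Hp] := cell i j Hi Hj.
exists p => l; have [a [b Hab]] := rb l.
by exists (g (i + a)%N, g (j + b)%N).
Qed.

End Sperner.

(** * Affine inequalities near a point, and propagation along a segment *)

Section Affine.
Variable R : realType.

Definition aff (g : R * R * R) (p : R * R) : R := g.1.1 + g.1.2 * p.1 + g.2 * p.2.

Lemma aff_pos_stable1 (g : R * R * R) p : 0 < aff g p ->
  exists2 e, 0 < e & forall q,
    `|q.1 - p.1| < e -> `|q.2 - p.2| < e -> 0 < aff g q.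
Proof.
move=> h; pose m := `|g.1.2| + `|g.2| + 1.
have m0 : 0 < m by rewrite ltr_wpDl // addr_ge0.
exists (aff g p / m); first by rewrite divr_gt0.
move=> q; rewrite !ltr_pdivlMr // => h1 h2.
have -> : aff g q = aff g p + (g.1.2 * (q.1 - p.1) + g.2 * (q.2 - p.2)).
  by rewrite /aff; ring.
have bnd : `|g.1.2 * (q.1 - p.1) + g.2 * (q.2 - p.2)| < aff g p.
  apply: le_lt_trans (ler_normD _ _) _; rewrite !normrM.
  case: (leP `|q.1 - p.1| `|q.2 - p.2|) => hh.
    apply: le_lt_trans h2; rewrite /m mulrDr mulr1 mulrDr.
    have := ler_wpM2l (normr_ge0 g.1.2) hh; have := normr_ge0 (q.2 - p.2); lra.
  apply: le_lt_trans h1; rewrite /m mulrDr mulr1 mulrDr.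
  have := ler_wpM2l (normr_ge0 g.2) (ltW hh); have := normr_ge0 (q.1 - p.1); lra.
by move: bnd; rewrite ltr_norml => /andP[]; lra.
Qed.

Lemma aff_pos_stable (K : finType) (g : K -> R * R * R) p :
  exists2 e, 0 < e & forall q, `|q.1 - p.1| < e -> `|q.2 - p.2| < e ->
    forall k, 0 < aff (g k) p -> 0 < aff (g k) q.
Proof.
suff [e e0 He] : exists2 e, 0 < e & forall q,
    `|q.1 - p.1| < e -> `|q.2 - p.2| < e ->
    forall k, k \in enum K -> 0 < aff (g k) p -> 0 < aff (g k) q.
  by exists e => // q h1 h2 k; apply: He => //; rewrite mem_enum.
elim: (enum K) => [|k s [e e0 IH]]; first by exists 1.
have [h|h] := ltP 0 (aff (g k) p); last first.
  exists e => // q h1 h2 k'; rewrite inE => /orP[/eqP ->|]; last exact: IH.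
  by move=> h'; move: (lt_le_trans h' h); rewrite ltxx.
have [e' e'0 He'] := aff_pos_stable1 h.
exists (Num.min e e'); first by rewrite lt_min e0.
move=> q; rewrite !lt_min => /andP[a1 a2] /andP[b1 b2] k'.
by rewrite inE => /orP[/eqP -> _|]; [apply: He'|apply: IH].
Qed.

(** The unit interval is cut into steps shorter than a Lebesgue number, so the two ends of a step
    share a neighbourhood [P p], across which [Q] is carried. The second coordinate of the square is
    a dummy. *)
Lemma propagate_segment (P : R -> R -> Prop) (Q : R -> Prop) :
  (forall t, exists2 e, 0 < e & forall t', `|t' - t| < e -> P t t') ->
  (forall t t1 t2, P t t1 -> P t t2 -> Q t1 -> Q t2) -> Q 0 -> Q 1.
Proof.
move=> locP PQ Q0.
have [|d d0 Hd] := @lebesgue_number_square R (fun p q => P p.1 q.1) 1.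
  by move=> p; have [e e0 He] := locP p.1; exists e => // q h _; apply: He.
pose n := (Num.truncn d^-1).+1.
have n0 : 0 < n%:R :> R by rewrite ltr0n.
have nd : n%:R^-1 < d.
  by rewrite invf_plt ?posrE //; apply: truncnS_gt.
suff H i : (i <= n)%N -> Q (i%:R / n%:R).
  by have := H n (leqnn _); rewrite divff // gt_eqF.
elim: i => [|i IH] Hi; first by rewrite mul0r.
have [||[p p'] /= Hp] := Hd (i%:R / n%:R, 0) => /=.
- rewrite ger0_norm ?divr_ge0 // ler_pdivrMr // mul1r ler_nat; exact: ltnW.
- by rewrite normr0.
apply: (PQ p (i%:R / n%:R)); last exact/IH/ltnW.
- by apply: (Hp (_, 0)); rewrite /= subrr normr0.
- apply: (Hp (_, 0)); rewrite /= ?subrr ?normr0 //.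
  by rewrite -mulrBl -natrB // subSnn mul1r gtr0_norm // invr_gt0.
Qed.

End Affine.

(** * Sets cut off by a line *)

Section Lowest.
Variables (R : realType) (T : finType).
Implicit Types (D S : {set T}) (key : T -> R).

(** Initial segments for [key]. Ties may be broken in any way, so the size does not determine
    [S]. *)
Definition lowest D key S : Prop :=
  S \subset D /\ forall i j, i \in S -> j \in D :\: S -> key i <= key j.

Lemma lowest_extend D key S s : lowest D key S -> (#|S| <= s <= #|D|)%N ->
  exists S', [/\ lowest D key S', S \subset S' & #|S'| = s].
Proof.
move=> lS /andP[Ss sD]; rewrite -(subnK Ss) in sD *.
elim: (s - #|S|)%N sD => [|m IH] sD; first by exists S.
have [|S' [[S'D lS'] SS' cS']] := IH; first exact: ltnW.
have /card_gt0P [j0 j0D] : (0 < #|D :\: S'|)%N.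
  by rewrite cardsDS // subn_gt0 cS'.
have [j jD jmin] := arg_minP key j0D.
have {}jD : j \in D :\: S' by [].
have jS' : j \notin S' by move: jD; rewrite inE => /andP[].
have jD' : j \in D by move: jD; rewrite inE => /andP[].
exists (j |: S'); split.
- split; first by rewrite subUset sub1set jD'.
  move=> i k; rewrite !inE negb_or => /orP[/eqP ->|iS'] /andP[/andP[kj kS'] kD].
    by apply: (jmin k); rewrite -[X in is_true X]/(k \in D :\: S') !inE kS'.
  by apply: lS' => //; rewrite inE kS'.
- by apply: subset_trans SS' _; apply: subsetUr.
- by rewrite cardsU1 jS' cS' add1n addSn.
Qed.

Lemma lowest0 D key : lowest D key set0.
Proof. by split; [apply: sub0set | move=> i j; rewrite inE]. Qed.

Lemma lowest_exists D key s : (s <= #|D|)%N ->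
  exists2 S, lowest D key S & #|S| = s.
Proof.
move=> sD; have [|S [lS _ cS]] := lowest_extend (s := s) (lowest0 D key).
  by rewrite cards0.
by exists S.
Qed.

End Lowest.

Section Halfset.
Variables (R : realType) (T : finType) (px py : T -> R).
Implicit Types (A B D S : {set T}).

Definition det i j k : R :=
  (px j - px i) * (py k - py i) - (py j - py i) * (px k - px i).

Definition noncollinear : Prop :=
  forall i j k, i != j -> i != k -> j != k -> det i j k != 0.

Definition lin (d : R * R) i : R := d.1 * px i + d.2 * py i.

(* Only weak separation is required, a closed condition; for disjoint sets it is upgraded by
   [separated_strict]. *)
Definition wsep A B : Prop :=
  exists2 d, d != (0, 0) & forall i j, i \in A -> j \in B -> lin d i <= lin d j.

Definition halfset D S : Prop := S \subset D /\ wsep S (D :\: S).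

Lemma lin_opp d i : lin (- d.1, - d.2) i = - lin d i.
Proof. by rewrite /lin /=; ring. Qed.

Lemma wsep_sym A B : wsep A B -> wsep B A.
Proof.
move=> [d d0 H]; exists (- d.1, - d.2).
  by move: d0; rewrite !xpair_eqE !oppr_eq0; case: d {H}.
by move=> i j iB jA; rewrite !lin_opp lerN2; apply: H.
Qed.

Lemma wsepS A B A' B' : A' \subset A -> B' \subset B -> wsep A B -> wsep A' B'.
Proof.
move=> /subsetP sA /subsetP sB [d d0 H]; exists d => // i j iA jB.
by apply: H; [apply: sA | apply: sB].
Qed.

Lemma halfsetC D S : halfset D S -> halfset D (D :\: S).
Proof.
move=> [SD h]; split; first exact: subsetDl.
by rewrite setDDr setDv set0U; apply: wsepS (wsep_sym h) => //; apply: subsetIr.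
Qed.

Lemma lowest_halfset D d S : d != (0, 0) -> lowest D (lin d) S -> halfset D S.
Proof. by move=> d0 [SD h]; split=> //; exists d. Qed.

Hypothesis nc : noncollinear.

Lemma line_lt3 d c i j k : d != (0, 0) ->
  lin d i = c -> lin d j = c -> lin d k = c -> i != j -> i != k -> j != k -> False.
Proof.
move=> d0 hi hj hk ij ik jk; move/eqP: (nc ij ik jk); apply.
have e1 : d.1 * (px j - px i) = - (d.2 * (py j - py i)).
  by move: hi hj; rewrite /lin; lra.
have e2 : d.1 * (px k - px i) = - (d.2 * (py k - py i)).
  by move: hi hk; rewrite /lin; lra.
have z1 : d.1 * det i j k = 0.
  rewrite /det mulrBr mulrA e1.
  rewrite (_ : d.1 * _ = (py j - py i) * (d.1 * (px k - px i))); last by ring.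
  by rewrite e2; ring.
have z2 : d.2 * det i j k = 0.
  rewrite /det mulrBr [X in _ - X]mulrA.
  rewrite (_ : d.2 * (py j - _) = - (d.1 * (px j - px i))); last by rewrite e1; ring.
  rewrite (_ : d.2 * _ = (px j - px i) * (d.2 * (py k - py i))); last by ring.
  rewrite (_ : d.2 * (py k - _) = - (d.1 * (px k - px i))); last by rewrite e2; ring.
  by ring.
move/eqP: z1; rewrite mulf_eq0 => /orP[/eqP d1|/eqP //].
move/eqP: z2; rewrite mulf_eq0 => /orP[/eqP d2|/eqP //].
by case/negP: d0; case: d d1 d2 {hi hj hk e1 e2} => a b /= -> ->.
Qed.

Lemma cardsD_sym S S' : #|S| = #|S'| -> #|S :\: S'| = #|S' :\: S|.
Proof. by move=> h; have := cardsID S' S; have := cardsID S S'; rewrite setIC; lia. Qed.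

(** All points in which [S] and [S'] differ have the same value of [lin d]. Two points of [S :\: S']
    and one of [S' :\: S] would be three points on a line. *)
Lemma lowest_unique D d S S' : d != (0, 0) ->
  lowest D (lin d) S -> lowest D (lin d) S' -> #|S| = #|S'| -> (#|S :\: S'| <= 1)%N.
Proof.
move=> d0 [SD lS] [S'D lS'] cS; rewrite leqNgt; apply/negP => h.
have /card_gt1P [i [j [iS jS ij]]] := h.
rewrite cardsD_sym // in h; have [k kS] := card_gt0P (ltnW h).
have eqv u : u \in S :\: S' -> lin d u = lin d k.
  move: kS; rewrite !inE => /andP[kS kS'] /andP[uS' uS].
  apply/eqP; rewrite eq_le lS //; last by rewrite inE kS (subsetP S'D).
  by apply: lS' => //; rewrite inE uS' (subsetP SD).
have nk u : u \in S :\: S' -> u != k.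
  by move: kS; rewrite !inE => /andP[kS _] /andP[_ uS]; apply: contraNneq kS => <-.
by apply: (line_lt3 d0 (eqv _ iS) (eqv _ jS) erefl ij); apply: nk.
Qed.

Section Rotation.
Variables (D : {set T}) (s : nat) (Q : {set T} -> Prop).
Hypothesis sD : (s <= #|D|)%N.
Hypothesis Qswap : forall S S', halfset D S -> halfset D S' -> #|S| = s -> #|S'| = s ->
  (#|S :\: S'| <= 1)%N -> Q S -> Q S'.

Let lowQ d := forall S, lowest D (lin d) S -> #|S| = s -> Q S.

Let lowQ1 d S : d != (0, 0) -> lowest D (lin d) S -> #|S| = s -> Q S -> lowQ d.
Proof.
move=> d0 lS cS QS S' lS' cS'.
apply: (Qswap (S := S)) => //; try exact: lowest_halfset d0 _.
by apply: lowest_unique d0 lS lS' _; rewrite cS cS'.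
Qed.

(** The direction runs along the segment from [d] to [d'], which avoids the origin by linear
    independence. Strict inequalities at [t] persist nearby, so sets that are lowest for parameters
    near [t] are also lowest for [t], where [lowQ1] compares them. *)
Let lowQ_turn d d' : d.1 * d'.2 - d.2 * d'.1 != 0 -> lowQ d -> lowQ d'.
Proof.
move=> dd'; pose e t := ((1 - t) * d.1 + t * d'.1, (1 - t) * d.2 + t * d'.2).
have e0 t : e t != (0, 0).
  apply/negP => /eqP [h1 h2].
  have z1 : (1 - t) * (d.1 * d'.2 - d.2 * d'.1) = 0.
    rewrite (_ : _ * _ = ((1 - t) * d.1 + t * d'.1) * d'.2 - ((1 - t) * d.2 + t * d'.2) * d'.1).
      by rewrite h1 h2; ring.
    by ring.
  have z2 : t * (d.1 * d'.2 - d.2 * d'.1) = 0.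
    rewrite (_ : _ * _ = ((1 - t) * d.2 + t * d'.2) * d.1 - ((1 - t) * d.1 + t * d'.1) * d.2).
      by rewrite h1 h2; ring.
    by ring.
  move/eqP: z1; move/eqP: z2; rewrite !mulf_eq0 (negbTE dd') !orbF => /eqP ->.
  by rewrite subr0 oner_eq0.
have ed : e 0 = d by rewrite /e !subr0 !mul1r !mul0r !addr0; case: (d).
have ed' : e 1 = d' by rewrite /e subrr !mul1r !mul0r !add0r; case: (d').
rewrite -{1}ed -ed'.
pose P t t' := forall ij : T * T,
  0 < lin (e t) ij.1 - lin (e t) ij.2 -> 0 < lin (e t') ij.1 - lin (e t') ij.2.
apply: (propagate_segment (P := P) (Q := fun t => lowQ (e t))).
  move=> t.
  pose g (ij : T * T) := (lin d ij.1 - lin d ij.2,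
    (lin d' ij.1 - lin d ij.1) - (lin d' ij.2 - lin d ij.2), 0 : R).
  have gE t' ij : lin (e t') ij.1 - lin (e t') ij.2 = aff (g ij) (t', 0).
    by rewrite /lin /aff /g /e /lin /=; ring.
  have [r r0 Hr] := aff_pos_stable g (t, 0).
  exists r => // t' tt' ij; rewrite !gE; apply: (Hr (t', 0)) => //=.
  by rewrite subrr normr0.
have sub t t' S : P t t' -> lowest D (lin (e t')) S -> lowest D (lin (e t)) S.
  move=> Ptt' [SD lS]; split=> // i j iS jS; rewrite leNgt -subr_gt0.
  apply/negP => /(Ptt' (i, j)); rewrite subr_gt0 ltNge /=.
  by rewrite lS.
move=> t t1 t2 P1 P2 Q1 S lS cS.
have [S1 lS1 cS1] := lowest_exists (lin (e t1)) sD.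
have QS1 := Q1 _ lS1 cS1.
by apply: (lowQ1 (e0 t) (sub _ _ _ P1 lS1) cS1 QS1) => //; apply: sub P2 lS.
Qed.

Let lowQ_all d d' : d != (0, 0) -> d' != (0, 0) -> lowQ d -> lowQ d'.
Proof.
move=> d0 d'0.
have sq (a : R * R) : a != (0, 0) -> a.1 * a.1 + a.2 * a.2 != 0.
  case: a => a b /=; apply: contra; rewrite xpair_eqE -!expr2 paddr_eq0 ?sqr_ge0 //.
  by rewrite !sqrf_eq0.
have [h|h] := eqVneq (d.1 * d'.2 - d.2 * d'.1) 0; last exact: lowQ_turn.
(* Parallel directions, equal or opposite, are joined through a perpendicular one. *)
move=> Qd; apply: (@lowQ_turn (- d.2, d.1)) => /=.
  apply/eqP => h2.
  have z1 : d.1 * (d'.1 * d'.1 + d'.2 * d'.2) = 0.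
    rewrite (_ : _ * _ = (d.1 * d'.2 - d.2 * d'.1) * d'.2
                       - (- d.2 * d'.2 - d.1 * d'.1) * d'.1); last by ring.
    by rewrite h h2; ring.
  have z2 : d.2 * (d'.1 * d'.1 + d'.2 * d'.2) = 0.
    rewrite (_ : _ * _ = - (d.1 * d'.2 - d.2 * d'.1) * d'.1
                       - (- d.2 * d'.2 - d.1 * d'.1) * d'.2); last by ring.
    by rewrite h h2; ring.
  move/eqP: z1; move/eqP: z2; rewrite !mulf_eq0 (negbTE (sq _ d'0)) !orbF => /eqP h3 /eqP h4.
  by move: d0; case: (d) h3 h4 => a b /= -> ->; rewrite eqxx.
apply: lowQ_turn Qd => /=.
by rewrite mulrN opprK; apply: sq.
Qed.

(* Turning the direction continuously exchanges at most one pair of points at a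
   time, since no line carries three points. *)
Lemma halfset_rotate S S' : halfset D S -> halfset D S' -> #|S| = s -> #|S'| = s ->
  Q S -> Q S'.
Proof.
move=> [SD [d d0 h]] [S'D [d' d'0 h']] cS cS' QS.
by apply: (lowQ_all d0 d'0) => //; apply: (lowQ1 d0 (S := S)).
Qed.

End Rotation.
End Halfset.

(** * Fans with one ray pointing downwards *)

Section Fan.
Variables (R : realType) (T : finType) (px py : T -> R).
Variables (D : {set T}) (nA nB : nat).
Implicit Types (p : R * R) (L A B : {set T}).

Definition cross p i j : R :=
  (px i - p.1) * (py j - p.2) - (py i - p.2) * (px j - p.1).

(* The vertical line through the apex [p] splits [D] into [L] and [D :\: L]; [A] consists of
   the [nA] points of [L] that come first clockwise from the downward direction, [B] of the
   [nB] points of [D :\: L] that come first counterclockwise, and [C] is the rest.  All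
   inequalities are weak, so that fans survive limits of apices and may have ties. *)
Definition prefan p L A B : Prop :=
  [/\ A \subset L, L \subset D, B \subset D :\: L, #|A| = nA & #|B| = nB] /\
  [/\ forall i, i \in L -> px i <= p.1,
      forall i, i \in D :\: L -> p.1 <= px i,
      forall i j, i \in A -> j \in L :\: A -> cross p i j <= 0 &
      forall i j, i \in (D :\: L) :\: B -> j \in B -> cross p i j <= 0].

(* The part [C] spans an angle of at most, respectively at least, a half-turn at [p]. The
   second clause of [reflex] has content only when a point of [C] sits at the apex. *)
Definition legit p L A B : Prop :=
  forall i j, i \in L :\: A -> j \in (D :\: L) :\: B -> cross p i j <= 0.

Definition reflex p L A B : Prop :=
  (exists i j, [/\ i \in L :\: A, j \in (D :\: L) :\: B & 0 <= cross p i j]) /\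
  (forall i j, i \in A -> j \in B -> 0 <= cross p i j).

(** Slopes replace angles at the apex: nearer to the downward ray means a larger slope on the left
    and a smaller one on the right. On the vertical line the value is the default 0, so that line is
    always treated separately. *)
Definition slope p i : R := (py i - p.2) / (px i - p.1).

Lemma slopeE p i : px i != p.1 -> py i - p.2 = slope p i * (px i - p.1).
Proof. by move=> h; rewrite /slope divfK // subr_eq0. Qed.

Lemma crossE p i j : px i != p.1 -> px j != p.1 ->
  cross p i j = (px i - p.1) * (px j - p.1) * (slope p j - slope p i).
Proof. by move=> hi hj; rewrite /cross !slopeE //; ring. Qed.

Lemma cross_ll p i j : px i < p.1 -> px j < p.1 ->
  (cross p i j <= 0) = (slope p j <= slope p i).
Proof.
move=> hi hj; rewrite crossE ?lt_eqF // pmulr_rle0 ?subr_le0 //.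
by rewrite nmulr_rgt0 subr_lt0.
Qed.

Lemma cross_rr p i j : p.1 < px i -> p.1 < px j ->
  (cross p i j <= 0) = (slope p j <= slope p i).
Proof.
move=> hi hj; rewrite crossE ?gt_eqF // pmulr_rle0 ?subr_le0 //.
by rewrite mulr_gt0 // subr_gt0.
Qed.

Lemma cross_lr p i j : px i < p.1 -> p.1 < px j ->
  (cross p i j <= 0) = (slope p i <= slope p j).
Proof.
move=> hi hj; rewrite crossE ?(lt_eqF hi) ?(gt_eqF hj) // nmulr_rle0 ?subr_ge0 //.
by rewrite nmulr_rlt0 ?subr_gt0 ?subr_lt0.
Qed.

Lemma cross_lr_ge0 p i j : px i < p.1 -> p.1 < px j ->
  (0 <= cross p i j) = (slope p j <= slope p i).
Proof.
move=> hi hj; rewrite crossE ?(lt_eqF hi) ?(gt_eqF hj) // nmulr_rge0 ?subr_le0 //.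
by rewrite nmulr_rlt0 ?subr_gt0 ?subr_lt0.
Qed.

Lemma cross_anti p i j : cross p j i = - cross p i j.
Proof. by rewrite /cross; ring. Qed.

Hypothesis nc : noncollinear px py.
Hypothesis pxI : injective px.
Hypotheses (nA0 : (0 < nA)%N) (nB0 : (0 < nB)%N).

Lemma vertical_eq p i j : px i = p.1 -> px j = p.1 -> i = j.
Proof. by move=> hi hj; apply: pxI; rewrite hi. Qed.

Lemma cross_collinear p i j k : px i != p.1 ->
  cross p i j = 0 -> cross p i k = 0 -> i != j -> i != k -> j != k -> False.
Proof.
move=> hi hj hk.
apply: (@line_lt3 _ _ _ _ nc (- (py i - p.2), px i - p.1)
          (- (py i - p.2) * p.1 + (px i - p.1) * p.2)).
- by rewrite xpair_eqE subr_eq0 (negbTE hi) andbF.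
- by rewrite /lin /=; ring.
- by move: hj; rewrite /cross /lin /=; lra.
- by move: hk; rewrite /cross /lin /=; lra.
Qed.

Lemma slopes_separate (X Y : {set T}) (f : T -> R) :
  (forall i j, i \in X -> j \in Y -> f i <= f j) ->
  exists m, (forall i, i \in X -> f i <= m) /\ (forall j, j \in Y -> m <= f j).
Proof.
move=> H; have [X0|[x0 xX]] := set_0Vmem X.
  have [Y0|[y0 yY]] := set_0Vmem Y.
    by exists 0; split=> i; rewrite ?X0 ?Y0 inE.
  have [y yY' ymin] := arg_minP f yY.
  by exists (f y); split=> i; [rewrite X0 inE | apply: ymin].
have [x xX' xmax] := arg_maxP f xX.
by exists (f x); split=> i; [apply: xmax | apply: H].
Qed.

Section One.
Variables (p : R * R) (L A B : {set T}).
Hypothesis pf : prefan p L A B.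

Lemma strictA i : i \in A -> px i != p.1 -> px i < p.1.
Proof.
move: pf => [[/subsetP AL _ _ _ _] [lL _ _ _]] iA.
by rewrite lt_neqAle => ->; rewrite lL ?AL.
Qed.

Lemma strict_inL i : i \in D -> px i < p.1 -> i \in L.
Proof.
move: pf => [_ [_ rL _ _]] iD hi; apply: contraT => iL.
by move: (rL i); rewrite inE iL iD leNgt hi => /(_ isT).
Qed.

Lemma strictA_card : (nA.-1 <= #|[set i in A | (px i < p.1)%R]|)%N.
Proof.
have [[_ _ _ cA _] _] := pf.
rewrite -cA -(cardsID [set i | px i < p.1] A).
have -> : A :&: [set i | px i < p.1] = [set i in A | px i < p.1].
  by apply/setP => i; rewrite !inE.
suff : (#|A :\: [set i | (px i < p.1)%R]| <= 1)%N by lia.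
apply/card_le1_eqP => i j; rewrite !inE => /andP[hi iA] /andP[hj jA].
have v k : k \in A -> ~~ (px k < p.1) -> px k = p.1.
  by move=> kA hk; apply/eqP; apply: contraNT hk; apply: strictA.
by apply: (@vertical_eq p); apply: v.
Qed.

(** The vertical line carries one point at most, so any point of [A] is strictly left of the apex.
    Coming after it clockwise, [i] cannot be below the apex. *)
Lemma above_L i : i \in L :\: A -> px i = p.1 -> p.2 <= py i.
Proof.
have [[_ _ _ cA _] [_ _ oA _]] := pf; move=> iC vi.
have [a aA] : exists a, a \in A by apply/card_gt0P; rewrite cA.
have ha : px a < p.1.
  apply: strictA => //; apply/eqP => va; move: iC.
  by rewrite inE (vertical_eq vi va) aA.
have := oA _ _ aA iC; rewrite /cross vi subrr mulr0 subr0.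
by rewrite nmulr_rle0 ?subr_ge0 ?subr_lt0.
Qed.

Lemma above_R i : i \in (D :\: L) :\: B -> px i = p.1 -> p.2 <= py i.
Proof.
have [[_ _ /subsetP BL _ cB] [_ rL _ oB]] := pf; move=> iC vi.
have [b bB] : exists b, b \in B by apply/card_gt0P; rewrite cB.
have hb : p.1 < px b.
  rewrite lt_neqAle rL ?BL // andbT; apply/eqP => vb; move: iC.
  by rewrite inE (@vertical_eq p i b) // bB.
have := oB _ _ iC bB; rewrite /cross vi subrr mul0r sub0r oppr_le0.
by rewrite pmulr_lge0 ?subr_ge0 ?subr_gt0.
Qed.

Lemma below_A i j : i \in A -> px i = p.1 -> j \in L :\: A -> py i <= p.2.
Proof.
have [[_ _ _ cA _] [lL _ oA _]] := pf; move=> iA vi jC.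
have hj : px j < p.1.
  rewrite lt_neqAle; apply/andP; split; last by apply: lL; move: jC; rewrite inE => /andP[].
  by apply/eqP => vj; move: jC; rewrite inE (vertical_eq vj vi) iA.
have := oA _ _ iA jC; rewrite /cross vi subrr mul0r sub0r oppr_le0.
by rewrite nmulr_lge0 ?subr_le0 ?subr_lt0.
Qed.

Lemma slope_strict_inA i j : i \in A -> px i < p.1 -> j \in D -> px j < p.1 ->
  slope p i < slope p j -> j \in A.
Proof.
have [_ [_ _ oA _]] := pf; move=> iA hi jD hj hs; apply: contraT => jA.
have := oA _ j iA; rewrite inE jA strict_inL // => /(_ isT).
by rewrite cross_ll // leNgt hs.
Qed.

(** At least [nA - 1] points of [A] are strictly left of the apex, hence these are all such points
    of [D], and the vertical line cuts off [A]. *)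
Lemma few_left_halfset : (#|[set i in D | (px i < p.1)%R]| < nA)%N -> halfset px py D A.
Proof.
have [[/subsetP AL /subsetP LD _ cA _] [lL _ _ _]] := pf.
move=> few; split; first by apply/subsetP => i iA; apply/LD/AL.
exists (1, 0); first by rewrite xpair_eqE oner_eq0.
move=> i j iA; rewrite inE => /andP[jA jD].
rewrite /lin /= !mul1r !mul0r !addr0 (le_trans (lL _ (AL _ iA))) // leNgt.
apply/negP => hj; move: few; rewrite ltnNge => /negP; apply.
suff : (#|j |: [set i in A | (px i < p.1)%R]| <= #|[set i in D | (px i < p.1)%R]|)%N.
  by apply: leq_trans; rewrite cardsU1 inE (negbTE jA); have := strictA_card; lia.
apply: subset_leq_card; apply/subsetP => k.
rewrite !inE => /orP[/eqP ->|/andP[kA ->]]; first by rewrite jD.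
by rewrite LD ?AL.
Qed.

Lemma mem_rest i : i \in D :\: (A :|: B) ->
  (i \in L :\: A) \/ (i \in (D :\: L) :\: B).
Proof.
by rewrite !inE negb_or => /andP[/andP[-> ->] ->]; case: (i \in L); [left|right].
Qed.

Lemma legit_wsep : legit p L A B -> wsep px py A (D :\: (A :|: B)).
Proof.
have [[/subsetP AL /subsetP LD _ cA _] [lL rL oA _]] := pf => lg.
have [[c [cC hc]]|noc] := boolp.pselect (exists c, c \in L :\: A /\ px c < p.1); last first.
  exists (1, 0); first by rewrite xpair_eqE oner_eq0.
  move=> i j iA jC; rewrite /lin /= !mul1r !mul0r !addr0 (le_trans (lL _ (AL _ iA))) //.
  have [jL|jR] := mem_rest jC; first by rewrite leNgt; apply/negP => h; apply: noc; exists j.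
  by apply: rL; move: jR; rewrite inE => /andP[].
(* The line of slope [m] through the apex has [A] weakly below it and the rest weakly above. *)
have [|m [m1 m2]] := @slopes_separate [set i in L :\: A | (px i < p.1)%R]
    [set i in A :|: ((D :\: L) :\: B) | px i != p.1] (slope p).
  move=> i j; rewrite in_set => /andP[iC hi]; rewrite in_set in_setU => /andP[/orP[jA|jR] vj].
    have hj := strictA jA vj.
    by rewrite -cross_ll // oA.
  rewrite -cross_lr //; first exact: lg.
  by rewrite lt_neqAle eq_sym vj rL //; move: jR; rewrite inE => /andP[].
exists (- m, 1); first by rewrite xpair_eqE oner_eq0 andbF.
suff H : (forall i, i \in A -> py i - p.2 <= m * (px i - p.1)) /\
    (forall i, i \in D :\: (A :|: B) -> m * (px i - p.1) <= py i - p.2).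
  by move=> i j iA jC; have := H.1 _ iA; have := H.2 _ jC; rewrite /lin /=; lra.
split=> i.
  move=> iA; have [v|v] := eqVneq (px i) p.1.
    by rewrite v subrr mulr0 subr_le0; apply: below_A cC.
  rewrite slopeE // ler_wnM2r ?subr_le0 ?lL ?AL // m2 // inE v in_setU iA //.
move=> iC; have [v|v] := eqVneq (px i) p.1.
  rewrite v subrr mulr0 subr_ge0; have [iL|iR] := mem_rest iC; first exact: above_L.
  exact: above_R.
rewrite slopeE //; have [iL|iR] := mem_rest iC.
  have hi : px i < p.1.
    by rewrite lt_neqAle v lL //; move: iL; rewrite inE => /andP[].
  by rewrite ler_wnM2r ?subr_le0 ?(ltW hi) // m1 // inE iL.
rewrite ler_wpM2r ?subr_ge0 //; first by apply: rL; move: iR; rewrite inE => /andP[].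
by rewrite m2 // inE v in_setU iR orbT.
Qed.

(** The cutting line passes through the apex. Its slope exists by four comparisons: [legit] for the
    two halves of the rest, the second hypothesis for [B] and [A], and the order of the fan on each
    side. *)
Lemma legit_halfset : legit p L A B ->
  (forall a b, a \in A -> b \in B -> px a < p.1 -> p.1 < px b ->
     slope p b <= slope p a) ->
  (forall i, i \in A :|: B -> px i = p.1 -> py i <= p.2) ->
  halfset px py D (D :\: (A :|: B)).
Proof.
have [[/subsetP AL /subsetP LD /subsetP BL _ _] [lL rL oA oB]] := pf => lg ab_le vab.
have sB i : i \in B -> px i != p.1 -> p.1 < px i.
  by move=> iB v; rewrite lt_neqAle eq_sym v rL ?BL.
have sCL i : i \in L :\: A -> px i != p.1 -> px i < p.1.
  by move=> iC v; rewrite lt_neqAle v lL //; move: iC; rewrite inE => /andP[].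
have sCR i : i \in (D :\: L) :\: B -> px i != p.1 -> p.1 < px i.
  by move=> iC v; rewrite lt_neqAle eq_sym v rL //; move: iC; rewrite inE => /andP[].
have [|m [m1 m2]] := @slopes_separate [set i in (L :\: A) :|: B | px i != p.1]
    [set i in A :|: ((D :\: L) :\: B) | px i != p.1] (slope p).
  move=> i j; rewrite in_set => /andP[iX vi]; rewrite in_set => /andP[jY vj].
  case/setUP: iX => [iC|iB]; case/setUP: jY => [jA|jC].
  - by have hi := sCL _ iC vi; have hj := strictA jA vj; rewrite -cross_ll // oA.
  - by have hi := sCL _ iC vi; have hj := sCR _ jC vj; rewrite -cross_lr // lg.
  - by have hi := sB _ iB vi; have hj := strictA jA vj; rewrite ab_le.
  - by have hi := sB _ iB vi; have hj := sCR _ jC vj; rewrite -cross_rr // oB.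
split; first exact: subsetDl.
exists (m, -1); first by rewrite xpair_eqE oppr_eq0 oner_eq0 andbF.
suff H : (forall i, i \in D :\: (A :|: B) -> m * (px i - p.1) <= py i - p.2) /\
    (forall i, i \in A :|: B -> py i - p.2 <= m * (px i - p.1)).
  move=> i j iC jAB.
  have jAB' : j \in A :|: B.
    by move: jAB; rewrite !inE; case: (j \in D); rewrite ?andbT ?negbK ?andbF.
  by have := H.1 _ iC; have := H.2 _ jAB'; rewrite /lin /=; lra.
split=> i.
  move=> iC; have [v|v] := eqVneq (px i) p.1.
    rewrite v subrr mulr0 subr_ge0.
    by have [iL|iR] := mem_rest iC; [exact: above_L|exact: above_R].
  rewrite slopeE //; have [iL|iR] := mem_rest iC.
    by rewrite ler_wnM2r ?subr_le0 ?(ltW (sCL _ iL v)) // m1 // inE v in_setU iL.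
  by rewrite ler_wpM2r ?subr_ge0 ?(ltW (sCR _ iR v)) // m2 // inE v in_setU iR orbT.
move=> iAB; have [v|v] := eqVneq (px i) p.1.
  by rewrite v subrr mulr0 subr_le0 vab.
rewrite slopeE //; case/setUP: iAB => [iA|iB].
  by rewrite ler_wnM2r ?subr_le0 ?(ltW (strictA iA v)) // m2 // inE v in_setU iA.
by rewrite ler_wpM2r ?subr_ge0 ?(ltW (sB _ iB v)) // m1 // inE v in_setU iB orbT.
Qed.

Lemma high_apex_halfset : legit p L A B -> (forall i, i \in D -> py i < p.2) ->
  halfset px py D (D :\: (A :|: B)).
Proof.
have [[/subsetP AL /subsetP LD /subsetP BL _ _] _] := pf => lg low.
have BD i : i \in B -> i \in D by move/BL; rewrite inE => /andP[].
apply: legit_halfset => // [a b aA bB ha hb|i iAB _].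
  rewrite -cross_lr_ge0 // /cross.
  have := low _ (BD _ bB); have := low _ (LD _ (AL _ aA)); nra.
by apply/ltW/low; case/setUP: iAB => [/AL/LD|/BD].
Qed.

Lemma low_apex_legit : (forall i, i \in D -> p.2 < py i) -> legit p L A B.
Proof.
have [[/subsetP AL /subsetP LD _ _ _] [lL rL _ _]] := pf => low i j.
rewrite inE => /andP[_ iL]; rewrite inE => /andP[_ jR].
have jD : j \in D by move: jR; rewrite inE => /andP[].
have := lL _ iL; have := rL _ jR; have := low _ jD; have := low _ (LD _ iL).
by rewrite /cross; nra.
Qed.

Lemma low_apex_halfset : (forall i, i \in D -> p.2 < py i) -> halfset px py D A.
Proof.
have [[/subsetP AL /subsetP LD _ cA _] [lL rL oA _]] := pf => low.
split; first by apply/subsetP => i /AL/LD.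
have [[c cC]|noc] := boolp.pselect (exists c, c \in L :\: A); last first.
  exists (1, 0); first by rewrite xpair_eqE oner_eq0.
  move=> i j iA; rewrite inE => /andP[jA jD].
  rewrite /lin /= !mul1r !mul0r !addr0 (le_trans (lL _ (AL _ iA))) // rL // inE jD andbT.
  by apply/negP => jL; apply: noc; exists j; rewrite inE jA.
have sA i : i \in A -> px i < p.1.
  move=> iA; apply: strictA => //; apply/eqP => v.
  by have := below_A iA v cC; rewrite leNgt low ?LD ?AL.
have [|m [m1 m2]] := @slopes_separate [set i in L :\: A | px i != p.1] A (slope p).
  move=> i j; rewrite 2!in_set => /andP[/andP[iA iL] v] jA.
  have hi : px i < p.1 by rewrite lt_neqAle v lL.
  have hj := sA _ jA.
  by rewrite -cross_ll // oA // inE iA.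
have [a aA] : exists a, a \in A by apply/card_gt0P; rewrite cA.
(* A nonpositive slope keeps the points right of the apex above the line. *)
have m0 : m <= 0.
  apply: le_trans (m2 a aA) _; rewrite /slope mulr_ge0_le0 ?invr_le0 ?subr_le0 ?subr_ge0 //.
    by apply/ltW/low/LD/AL.
  exact/ltW/sA.
exists (- m, 1); first by rewrite xpair_eqE oner_eq0 andbF.
move=> i j iA; rewrite inE => /andP[jA jD].
have hi : py i - p.2 <= m * (px i - p.1).
  by rewrite slopeE ?lt_eqF ?sA // ler_wnM2r ?m2 // subr_le0 ltW ?sA.
have hj : m * (px j - p.1) <= py j - p.2.
  have [jL|jL] := boolP (j \in L); last first.
    have : p.1 <= px j by apply: rL; rewrite inE jL.
    by have := low _ jD; nra.
  have [v|v] := eqVneq (px j) p.1; first by rewrite v subrr mulr0 subr_ge0 ltW ?low.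
  rewrite slopeE // ler_wnM2r ?subr_le0 ?lL // m1 //.
  by rewrite !inE jA jL v.
by move: hi hj; rewrite /lin /=; lra.
Qed.

(** A pair [i], [j] with positive cross product lies off the vertical line. For [a] in [A] and [b]
    in [B] off that line the slopes then form a chain, [b] below [j] below [i] below [a], which is
    the second clause of [reflex]. *)
Lemma legit_or_reflex : legit p L A B \/ reflex p L A B.
Proof.
have [lg|nlg] := boolp.pselect (legit p L A B); [by left|right].
have [[/subsetP AL /subsetP LD /subsetP BL _ _] [lL rL oA oB]] := pf.
have [i [j [iC jC ij]]] : exists i j, [/\ i \in L :\: A, j \in (D :\: L) :\: B & 0 < cross p i j].
  apply: boolp.contrapT => H; apply: nlg => i j iC jC; rewrite leNgt; apply/negP => h.
  by apply: H; exists i, j.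
split; first by exists i, j; split=> //; apply: ltW.
have xi : px i <= p.1 by apply: lL; move: iC; rewrite inE => /andP[].
have xj : p.1 <= px j by apply: rL; move: jC; rewrite inE => /andP[].
have hi : px i < p.1.
  rewrite lt_neqAle xi andbT; apply/eqP => v; have := above_L iC v.
  by move: ij; rewrite /cross v subrr mul0r sub0r oppr_gt0; nra.
have hj : p.1 < px j.
  rewrite lt_neqAle xj andbT; apply/eqP => v; have := above_R jC (esym v).
  by move: ij; rewrite /cross v subrr mulr0 subr0; nra.
move=> a b aA bB.
have xa := lL _ (AL _ aA); have xb := rL _ (BL _ bB).
have [va|va] := eqVneq (px a) p.1.
  by have := below_A aA va iC; rewrite /cross va subrr mul0r sub0r oppr_ge0; nra.
have [vb|vb] := eqVneq (px b) p.1.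
  have := oB _ _ jC bB; rewrite /cross vb subrr mulr0 subr0 mulr0 subr0 => h.
  have hb : py b <= p.2 by move: h; rewrite pmulr_rle0 ?subr_gt0 // subr_le0.
  by nra.
have ha := strictA aA va.
have hb : p.1 < px b by rewrite lt_neqAle eq_sym vb.
rewrite cross_lr_ge0 //.
have := oA _ _ aA iC; rewrite cross_ll // => h1.
have := oB _ _ jC bB; rewrite cross_rr // => h2.
have : slope p j <= slope p i by rewrite -cross_lr_ge0 // ltW.
by move=> h3; apply: le_trans h2 (le_trans h3 h1).
Qed.

End One.

Lemma prefan_exists p :
  (nA <= #|[set i in D | (px i < p.1)%R]|)%N -> (nB <= #|[set i in D | (p.1 < px i)%R]|)%N ->
  exists L A B, prefan p L A B.
Proof.
set Lf := [set i in D | (px i < p.1)%R]; set Rt := [set i in D | (p.1 < px i)%R] => hA hB.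
have [B [/subsetP BR lB] cB] := lowest_exists (slope p) hB.
have BE i : i \in B -> i \in D /\ p.1 < px i by move/BR; rewrite inE => /andP[].
(* A point vertically below the apex is the first one clockwise and joins [A]; a point at or above
   the apex joins the left side but stays out of [A]. *)
have [[q [qD qv qb]]|noq] :=
    boolp.pselect (exists q, [/\ q \in D, px q = p.1 & py q < p.2]).
  have [|A [/subsetP AL lA] cA] :=
      lowest_exists (s := nA.-1) (fun i => - slope p i) (_ : (_ <= #|Lf|)%N).
    by apply: leq_trans hA; apply: leq_pred.
  have AE i : i \in A -> i \in D /\ px i < p.1 by move/AL; rewrite inE => /andP[].
  have qA : q \notin A by apply/negP => /AE []; rewrite qv ltxx.
  exists (q |: Lf), (q |: A), B; split; split.
  - by apply: setUS; apply/subsetP.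
  - by rewrite subUset sub1set qD; apply/subsetP => i; rewrite inE => /andP[].
  - apply/subsetP => i /BE [iD hi]; rewrite !inE iD andbT negb_or /=.
    rewrite -leNgt (ltW hi) andbT; apply/eqP => e; move: hi; rewrite e qv ltxx //.
  - by rewrite cardsU1 qA cA add1n prednK.
  - exact: cB.
  - by move=> i; rewrite !inE => /predU1P[->|/andP[_ /ltW //]]; rewrite qv.
  - move=> i; rewrite !inE negb_or negb_and => /andP[/andP[_ /orP[/negbTE ->|]]] //.
    by rewrite -leNgt.
  - move=> i j iA; rewrite !inE negb_or => /andP[/andP[jq jA] /predU1P[e|/andP[jD hj]]].
      by rewrite e eqxx in jq.
    case/setU1P: iA => [->|iA].
      by rewrite /cross qv subrr mul0r sub0r; nra.
    have [iD hi] := AE _ iA.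
    by rewrite cross_ll // -lerN2 lA // !inE jA jD.
  - move=> i j; rewrite !inE negb_or negb_and => /andP[iB /andP[/andP[iq hi] iD]] jB.
    have [jD hj] := BE _ jB.
    have xi : p.1 < px i.
      rewrite iD /= -leNgt in hi; rewrite lt_neqAle hi andbT; apply/eqP => v.
      by move/eqP: iq; apply; apply: (@vertical_eq p).
    by rewrite cross_rr // lB // !inE iB iD.
have [A [/subsetP AL lA] cA] := lowest_exists (fun i => - slope p i) hA.
have AE i : i \in A -> i \in D /\ px i < p.1 by move/AL; rewrite inE => /andP[].
exists [set i in D | px i <= p.1], A, B; split; split => //.
- by apply/subsetP => i /AE [iD /ltW hi]; rewrite inE iD.
- by apply/subsetP => i; rewrite inE => /andP[].
- by apply/subsetP => i /BE [iD hi]; rewrite !inE iD /= -ltNge hi.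
- by move=> i; rewrite inE => /andP[].
- by move=> i; rewrite !inE => /andP[+ iD]; rewrite iD /= -ltNge => /ltW.
- move=> i j iA; rewrite !inE => /andP[jA /andP[jD hj]]; have [iD hi] := AE _ iA.
  have [v|v] := eqVneq (px j) p.1.
    have : ~~ (py j < p.2) by apply/negP => h; apply: noq; exists j.
    by rewrite -leNgt /cross v subrr mulr0 subr0; nra.
  have hj' : px j < p.1 by rewrite lt_neqAle v.
  by rewrite cross_ll // -lerN2 lA // !inE jA jD.
- move=> i j; rewrite !inE => /andP[iB /andP[hi iD]] jB; have [jD hj] := BE _ jB.
  rewrite iD /= -ltNge in hi.
  by rewrite cross_rr // lB // !inE iB iD.
Qed.

Section Compare.
Variables (p : R * R) (L A B L' A' B' : {set T}).
Hypotheses (pf : prefan p L A B) (pf' : prefan p L' A' B').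

(** A point of [A :\: A'] and one of [A' :\: A], both strictly left of the apex, are tied and so
    collinear with it. Two exchanges would place three points on a line through the apex, as at most
    one point is on the vertical line. *)
Lemma prefan_swap : (#|A :\: A'| <= 1)%N.
Proof.
move: pf pf' => [[/subsetP AL /subsetP LD _ cA _] [lL rL oA _]].
move=> [[/subsetP AL' /subsetP LD' _ cA' _] [lL' rL' oA' _]].
rewrite leqNgt; apply/negP => h.
have /card_gt1P [i1 [i2 [i1A i2A ii]]] := h.
rewrite cardsD_sym ?cA // in h; have /card_gt1P [j1 [j2 [j1A j2A jj]]] := h.
have z i j : i \in A :\: A' -> j \in A' :\: A -> px i < p.1 -> px j < p.1 ->
    cross p i j = 0 /\ i != j.
  rewrite !inE => /andP[iA' iA] /andP[jA jA'] hi hj; split; last first.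
    by apply: contraNneq iA' => ->.
  apply/eqP; rewrite eq_le oA //; last first.
    rewrite inE jA /=; apply: contraT => jL; move: (rL j); rewrite inE jL LD' ?AL' //.
    by move=> /(_ isT); rewrite leNgt hj.
  rewrite -oppr_le0 -cross_anti oA' // inE iA' /=.
  apply: contraT => iL; move: (rL' i); rewrite inE iL LD ?AL //.
  by move=> /(_ isT); rewrite leNgt hi.
have sA i : i \in A :\: A' -> px i != p.1 -> px i < p.1.
  by rewrite inE lt_neqAle => /andP[_ iA] ->; rewrite lL ?AL.
have sA' i : i \in A' :\: A -> px i != p.1 -> px i < p.1.
  by rewrite inE lt_neqAle => /andP[_ iA] ->; rewrite lL' ?AL'.
have nij i j : i \in A :\: A' -> j \in A' :\: A -> i != j.
  by rewrite !inE => /andP[iA' iA] /andP[_ jA']; apply: contraNneq iA' => ->.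
have f1 i : i \in A :\: A' -> px i != p.1 -> px j1 != p.1 -> px j2 != p.1 -> False.
  move=> iA vi v1 v2.
  have [z1 n1] := z _ _ iA j1A (sA _ iA vi) (sA' _ j1A v1).
  have [z2 n2] := z _ _ iA j2A (sA _ iA vi) (sA' _ j2A v2).
  exact: cross_collinear z1 z2 n1 n2 jj.
have f2 j : j \in A' :\: A -> px j != p.1 -> px i1 != p.1 -> px i2 != p.1 -> False.
  move=> jA vj v1 v2.
  have [z1 n1] := z _ _ i1A jA (sA _ i1A v1) (sA' _ jA vj).
  have [z2 n2] := z _ _ i2A jA (sA _ i2A v2) (sA' _ jA vj).
  move: z1 z2 n1 n2; rewrite ![_ == j]eq_sym => z1 z2 n1 n2.
  by apply: (@cross_collinear p j i1 i2); rewrite // cross_anti ?z1 ?z2 oppr0.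
have [v1|v1] := eqVneq (px j1) p.1.
  apply: (f2 j2) => //; apply/negP => /eqP v; [|move: (nij _ _ i1A j1A)|move: (nij _ _ i2A j1A)].
  - by move/eqP: jj; apply; apply: vertical_eq v1 v.
  - by rewrite (vertical_eq v v1) eqxx.
  - by rewrite (vertical_eq v v1) eqxx.
have [v2|v2] := eqVneq (px j2) p.1.
  apply: (f2 j1) => //; apply/negP => /eqP v; [move: (nij _ _ i1A j2A)|move: (nij _ _ i2A j2A)].
  - by rewrite (vertical_eq v v2) eqxx.
  - by rewrite (vertical_eq v v2) eqxx.
have [w1|w1] := eqVneq (px i1) p.1; last exact: (f1 i1).
apply: (f1 i2) => //; apply/negP => /eqP w.
by move/eqP: ii; apply; apply: vertical_eq w1 w.
Qed.





(* Otherwise [A] would contain [a], [c] and the points of [A'] off the vertical line. *)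
Lemma inC_slope_le a c : a \in A -> px a < p.1 -> c \in L' :\: A' -> px c < p.1 ->
  slope p c <= slope p a.
Proof.
have [[_ _ _ cA _] _] := pf; have [[/subsetP AL' /subsetP LD' _ cA' _] [_ _ oA' _]] := pf'.
move=> aA ha cC hc; rewrite leNgt; apply/negP => hs.
have [cL cA''] : c \in L' /\ c \notin A' by move: cC; rewrite inE => /andP[].
have hA i : i \in A' -> px i < p.1 -> slope p a < slope p i.
  by move=> iA hi; apply: lt_le_trans hs _; rewrite -cross_ll // oA'.
suff : (#|a |: (c |: [set i in A' | (px i < p.1)%R])| <= nA)%N.
  rewrite !cardsU1 !inE (negbTE cA'') /=.
  have -> : a == c = false by apply/eqP => e; move: hs; rewrite e ltxx.
  have -> : (a \in A') && (px a < p.1) = false.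
    by apply/negP => /andP[aA' _]; move: (hA _ aA' ha); rewrite ltxx.
  by have := strictA_card pf'; move: nA0; lia.
rewrite -cA; apply: subset_leq_card; apply/subsetP => i.
rewrite !inE => /or3P[/eqP -> //|/eqP ->|/andP[iA hi]].
  by apply: (slope_strict_inA pf) hs => //; apply: LD'.
by apply: (slope_strict_inA pf) (hA _ iA hi) => //; apply/LD'/AL'.
Qed.

(** Otherwise [A] would contain [a] and all of [A'], one point too many. *)
Lemma inA_slope_le a : a \in A -> px a < p.1 -> (forall i, i \in A' -> px i < p.1) ->
  exists2 a', a' \in A' & slope p a' <= slope p a.
Proof.
have [[_ _ _ cA _] _] := pf; have [[/subsetP AL' /subsetP LD' _ cA' _] _] := pf'.
move=> aA ha sA'; apply: boolp.contrapT => H.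
have hs i : i \in A' -> slope p a < slope p i.
  by move=> iA; rewrite ltNge; apply/negP => h; apply: H; exists i.
suff : (#|a |: A'| <= nA)%N.
  rewrite cardsU1 cA'.
  by case aA' : (a \in A') => /=; [move: (hs _ aA'); rewrite ltxx | lia].
rewrite -cA; apply: subset_leq_card; apply/subsetP => i.
rewrite !inE => /predU1P[-> //|iA].
by apply: (slope_strict_inA pf) (hs _ iA) => //; [apply/LD'/AL' | apply: sA'].
Qed.

(** Since [i] is the only point on the vertical line and lies in [L], [L'] is contained in [L].
    Hence [L :\: A] is nonempty too and [below_A] applies. *)
Lemma below_A_transfer i : i \in A -> px i = p.1 -> (0 < #|L' :\: A'|)%N -> py i <= p.2.
Proof.
have [[/subsetP AL /subsetP LD _ cA _] _] := pf.
have [[AL' /subsetP LD' _ cA' _] [lL' _ _ _]] := pf'.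
move=> iA vi; rewrite cardsDS // cA' subn_gt0 => h.
have /card_gt0P [j jC] : (0 < #|L :\: A|)%N.
  rewrite cardsDS; last exact/subsetP.
  rewrite cA subn_gt0; apply: leq_trans h _; apply: subset_leq_card; apply/subsetP => k kL.
  have [v|v] := eqVneq (px k) p.1; first by rewrite (vertical_eq v vi) AL.
  by rewrite (strict_inL pf) ?LD' // lt_neqAle v lL'.
exact: (below_A pf) jC.
Qed.



End Compare.
End Fan.

(** * Linear changes of coordinates and mirror images of fans *)

Section ChangeCoordinates.
Variables (R : realType) (T : finType) (px px' py : T -> R).

Lemma wsep_change (A B : {set T}) :
  (forall d : R * R, d != (0, 0) ->
     exists2 d', d' != (0, 0) & forall i, lin px' py d i = lin px py d' i) ->
  wsep px' py A B -> wsep px py A B.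
Proof.
move=> H [d d0 AB]; have [d' d'0 E] := H d d0.
by exists d' => // i j iA jB; rewrite -!E AB.
Qed.

Lemma halfset_change (D S : {set T}) :
  (forall d : R * R, d != (0, 0) ->
     exists2 d', d' != (0, 0) & forall i, lin px' py d i = lin px py d' i) ->
  halfset px' py D S -> halfset px py D S.
Proof. by move=> H [SD h]; split=> //; apply: wsep_change h. Qed.

End ChangeCoordinates.

Section Reflection.
Variables (R : realType) (T : finType) (px py : T -> R) (D : {set T}) (nA nB : nat).
Hypothesis nc : noncollinear px py.
Hypothesis pxI : injective px.
Hypotheses (nA0 : (0 < nA)%N) (nB0 : (0 < nB)%N).

Let opx i := - px i.
Let opp1 (p : R * R) := (- p.1, p.2).

Let opxI : injective opx. Proof. by move=> i j /oppr_inj /pxI. Qed.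

Let nco : noncollinear opx py.
Proof.
move=> i j k ij ik jk; have := nc ij ik jk; apply: contra_neq.
by rewrite /det /opx => h; rewrite -[RHS]oppr0 -h; ring.
Qed.

Let lin_op (d : R * R) : d != (0, 0) ->
  exists2 d', d' != (0, 0) & forall i, lin opx py d i = lin px py d' i.
Proof.
move=> d0; exists (opp1 d); last by move=> i; rewrite /lin /opx /=; ring.
by move: d0; rewrite !xpair_eqE oppr_eq0; case: d.
Qed.

Let cross_op p i j : cross opx py (opp1 p) i j = cross px py p j i.
Proof. by rewrite /cross /opx /=; ring. Qed.

Let slope_op p i : slope opx py (opp1 p) i = - slope px py p i.
Proof. by rewrite /slope /opx /= -opprD invrN mulrN. Qed.

Let left_op p : [set i in D | (opx i < (opp1 p).1)%R] = [set i in D | (p.1 < px i)%R].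
Proof. by apply/setP => i; rewrite !inE /opx /= ltrN2. Qed.

Section State.
Variables (p : R * R) (L A B : {set T}).
Hypothesis pf : prefan px py D nA nB p L A B.

Let LD : L \subset D. Proof. by have [[]] := pf. Qed.
Let setDDL : D :\: (D :\: L) = L. Proof. by rewrite setDDr setDv set0U; apply/setIidPr. Qed.

(** The reflection in the vertical axis exchanges [A] and [B], so statements about the left part
    transfer to the right part. *)
Lemma prefan_op : prefan opx py D nB nA (opp1 p) (D :\: L) B A.
Proof.
have [[AL _ BL cA cB] [lL rL oA oB]] := pf; split; split; rewrite ?setDDL ?subsetDl //.
- by move=> i /rL; rewrite /opx /= lerN2.
- by move=> i /lL; rewrite /opx /= lerN2.
- by move=> i j iB jC; rewrite cross_op oB.
- by move=> i j iC jA; rewrite cross_op oA.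
Qed.

Lemma legit_op : legit px py D p L A B -> legit opx py D (opp1 p) (D :\: L) B A.
Proof. by move=> lg i j; rewrite setDDL => iC jC; rewrite cross_op lg. Qed.

Lemma few_right_halfset :
  (#|[set i in D | (p.1 < px i)%R]| < nB)%N -> halfset px py D B.
Proof.
rewrite -left_op => h; apply: (halfset_change lin_op).
exact: few_left_halfset prefan_op h.
Qed.

Lemma legit_wsep_right : legit px py D p L A B -> wsep px py B (D :\: (A :|: B)).
Proof.
move=> lg; apply: (wsep_change lin_op); rewrite setUC.
exact: legit_wsep prefan_op (legit_op lg).
Qed.

Lemma low_apex_halfset_right : (forall i, i \in D -> p.2 < py i) -> halfset px py D B.
Proof.
move=> low; apply: (halfset_change lin_op).
exact: low_apex_halfset prefan_op _.
Qed.

End State.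

Section Compare.
Variables (p : R * R) (L A B L' A' B' : {set T}).
Hypotheses (pf : prefan px py D nA nB p L A B) (pf' : prefan px py D nA nB p L' A' B').

Lemma prefan_swap_right : (#|B :\: B'| <= 1)%N.
Proof. exact (prefan_swap nco opxI (prefan_op pf) (prefan_op pf')). Qed.

(* This provides the boundary condition for [C]: no apex that is a limit of reflex fans has
   a legitimate fan with a surplus in [C]. *)
Lemma reflex_halfset : legit px py D p L A B -> reflex px py D p L' A' B' ->
  halfset px py D (D :\: (A :|: B)).
Proof.
have [[_ /subsetP LD' BL' cA' _] [lL' rL' _ _]] := pf'.
move=> lg [[c1 [c2 [c1C c2C c12]]] rx].
have xc1 : px c1 <= p.1 by apply: lL'; move: c1C; rewrite inE => /andP[].
have xc2 : p.1 <= px c2 by apply: rL'; move: c2C; rewrite inE => /andP[].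
apply: legit_halfset pf lg _ _ => // [a b aA bB ha hb|i /setUP[iA|iB] v].
- have [/andP[h1 h2]|h] := boolP ((px c1 < p.1) && (p.1 < px c2)).
    have s1 := inC_slope_le pxI nA0 nB0 pf pf' aA ha c1C h1.
    have s2 : slope px py p b <= slope px py p c2.
      have := @inC_slope_le _ _ opx py D nB nA opxI nB0 nA0 (opp1 p) _ _ _ _ _ _
        (prefan_op pf) (prefan_op pf') b c2 bB.
      by rewrite /opx /= !ltrN2 !slope_op lerN2; apply.
    have s3 : slope px py p c2 <= slope px py p c1 by rewrite -cross_lr_ge0.
    exact: le_trans s2 (le_trans s3 s1).
  (* Otherwise [c1] or [c2] occupies the vertical line, which then misses [A'] and [B']; the second
     clause of [reflex] takes over. *)
  have [q [qv qA qB]] : exists q, [/\ px q = p.1, q \notin A' & q \notin B'].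
    have [v1|v1] := eqVneq (px c1) p.1.
      exists c1; split=> //; first by move: c1C; rewrite inE => /andP[].
      apply/negP => /(subsetP BL'); rewrite inE.
      by move: c1C; rewrite inE => /andP[_ ->].
    have [v2|v2] := eqVneq (px c2) p.1; last first.
      by case/negP: h; rewrite !lt_neqAle v1 xc1 eq_sym v2.
    have [[AL' _ _ _ _] _] := pf'.
    exists c2; split=> //; last by move: c2C; rewrite inE => /andP[].
    apply/negP => /(subsetP AL') cL.
    by move: c2C; rewrite !inE cL andbF.
  have sA i : i \in A' -> px i < p.1.
    have [[/subsetP AL' _ _ _ _] _] := pf'.
    move=> iA; rewrite lt_neqAle lL' ?AL' // andbT; apply: contraNneq qA => v.
    by rewrite (@vertical_eq _ _ px pxI p q i).
  have sB i : i \in B' -> p.1 < px i.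
    move=> iB; rewrite lt_neqAle rL' ?(subsetP BL') // andbT; apply: contraNneq qB => v.
    by rewrite (@vertical_eq _ _ px pxI p q i).
  have [a' aA' sa] := inA_slope_le nA0 nB0 pf pf' aA ha sA.
  have [||b' bB' sb] := @inA_slope_le _ _ opx py D nB nA nB0 nA0 (opp1 p) _ _ _ _ _ _
        (prefan_op pf) (prefan_op pf') b bB.
  - by rewrite /opx /= ltrN2.
  - by move=> i iB; rewrite /opx /= ltrN2 sB.
  move: sb; rewrite !slope_op lerN2 => sb.
  have := rx _ _ aA' bB'; rewrite cross_lr_ge0 ?sA ?sB // => sab.
  exact: le_trans sb (le_trans sab sa).
- apply: (below_A_transfer pxI pf pf' iA v).
  by apply/card_gt0P; exists c1.
- apply: (@below_A_transfer _ _ opx py D nB nA opxI (opp1 p) _ _ _ _ _ _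
        (prefan_op pf) (prefan_op pf') i iB _ _).
    by rewrite /opx v.
  by apply/card_gt0P; exists c2.
Qed.

End Compare.
End Reflection.

Lemma card_setI_swap (T : finType) (A A' X : {set T}) :
  (#|A :\: A'| <= 1)%N -> (#|A :&: X| <= #|A' :&: X|.+1)%N.
Proof.
move=> h; have : (#|A :&: X| <= #|(A' :&: X) :|: (A :\: A')|)%N.
  apply: subset_leq_card; apply/subsetP => i; rewrite !inE => /andP[-> ->].
  by case: (i \in A').
have := cardsU (A' :&: X) (A :\: A'); lia.
Qed.

(** * The three-part cut from Sperner's lemma *)

Section ThreeCut.
Variables (R : realType) (T : finType) (px py : T -> R).
Variables (D X : {set T}) (nA nB nC a b c : nat).
Hypothesis nc : noncollinear px py.
Hypotheses (nA0 : (0 < nA)%N) (nB0 : (0 < nB)%N).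
Hypothesis cD : #|D| = (nA + nB + nC)%N.
Hypothesis cX : #|D :&: X| = (a + b + c)%N.
Hypothesis hA : forall S, halfset px py D S -> #|S| = nA -> (#|S :&: X| < a)%N.
Hypothesis hB : forall S, halfset px py D S -> #|S| = nB -> (#|S :&: X| < b)%N.
Hypothesis hC : forall S, halfset px py D S -> #|S| = nC -> (#|S :&: X| < c)%N.

Section DistinctAbscissae.
Hypothesis pxI : injective px.

Let fan := prefan px py D nA nB.

(* A part with a surplus of points of [X] compared with the targets [a], [b], [c]; when
   there is no surplus in [A] and [B], it is in [C] or the fan is exact. *)
Definition fan_label (A B : {set T}) : label :=
  if (b < #|B :&: X|)%N then lB else if (a < #|A :&: X|)%N then lA else lC.

Let few_left (p : R * R) := (#|[set i in D | (px i < p.1)%R]| < nA)%N.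
Let few_right (p : R * R) := (#|[set i in D | (p.1 < px i)%R]| < nB)%N.

(* An apex without an honest three-part fan gets a label that the boundary conditions allow
   nearby.  This relation is closed in the apex and may relate it to several labels. *)
Let fan_labelled p l : Prop :=
  exists L A B, fan p L A B /\
    ((legit px py D p L A B /\ l = fan_label A B) \/ (reflex px py D p L A B /\ l = lA)).

Let weak_label p l : Prop :=
  (few_left p /\ l = lB) \/ (few_right p /\ l = lA) \/ fan_labelled p l.

(** Strict inequalities pass from [p] to [p']; contrapositively, the weak inequalities that define
    fans pass from [p'] back to [p]. *)
Let refines (p p' : R * R) : Prop :=
  [/\ forall i, px i < p.1 -> px i < p'.1, forall i, p.1 < px i -> p'.1 < px i &
      forall i j, 0 < cross px py p i j -> 0 < cross px py p' i j].

Let refines_near p : exists2 e, 0 < e &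
  forall q, `|q.1 - p.1| < e -> `|q.2 - p.2| < e -> refines p q.
Proof.
(* The quadratic terms of [cross] cancel, so it is affine in the apex. *)
pose g (k : T * T + T * bool) : R * R * R := match k with
  | inl ij => (px ij.1 * py ij.2 - py ij.1 * px ij.2, py ij.1 - py ij.2, px ij.2 - px ij.1)
  | inr (i, true) => (px i, - 1, 0)
  | inr (i, false) => (- px i, 1, 0)
  end.
have [e e0 He] := aff_pos_stable g p; exists e => // q h1 h2; split.
- move=> i; have := He q h1 h2 (inr (i, false)); rewrite /aff /= => H h.
  by have : 0 < - px i + 1 * q.1 + 0 * q.2; [apply: H; lra | lra].
- move=> i; have := He q h1 h2 (inr (i, true)); rewrite /aff /= => H h.
  by have : 0 < px i + - 1 * q.1 + 0 * q.2; [apply: H; lra | lra].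
- have E r i j : cross px py r i j = aff (g (inl (i, j))) r.
    by rewrite /cross /aff /=; ring.
  by move=> i j; rewrite !E; apply: He.
Qed.

Let weak_label_refines p p' l : refines p p' -> weak_label p' l -> weak_label p l.
Proof.
move=> [rl rr rc].
have cr i j : cross px py p' i j <= 0 -> cross px py p i j <= 0.
  by rewrite !leNgt; apply: contra; apply: rc.
have cr0 i j : 0 <= cross px py p' i j -> 0 <= cross px py p i j.
  by move=> h; rewrite -oppr_le0 -cross_anti cr // cross_anti oppr_le0.
move=> [[fl ->]|[[fr ->]|[L [A [B [pf H]]]]]].
- left; split=> //; apply: leq_ltn_trans fl; apply: subset_leq_card.
  by apply/subsetP => i; rewrite !inE => /andP[-> /rl].
- right; left; split=> //; apply: leq_ltn_trans fr; apply: subset_leq_card.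
  by apply/subsetP => i; rewrite !inE => /andP[-> /rr].
right; right; exists L, A, B; split.
  have [h1 [lL lR oA oB]] := pf; split=> //; split.
  - by move=> i /lL; rewrite !leNgt; apply: contra; apply: rr.
  - by move=> i /lR; rewrite !leNgt; apply: contra; apply: rl.
  - by move=> i j iA jC; apply/cr/oA.
  - by move=> i j iA jC; apply/cr/oB.
case: H => [[lg ->]|[[[i [j [iC jC ij]]] rf] ->]]; [left|right]; split=> //.
  by move=> i j iC jC; apply/cr/lg.
split; first by exists i, j; split=> //; apply: cr0.
by move=> i' j' h1 h2; apply/cr0/rf.
Qed.

(** With at most one point on the vertical line, [D] would have at most [nA + nB - 1] points. *)
Let few_left_right p : few_left p -> few_right p -> False.
Proof.
rewrite /few_left /few_right => h1 h2.
set Lf := [set i in D | (px i < p.1)%R] in h1.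
set Rt := [set i in D | (p.1 < px i)%R] in h2.
have v1 : (#|D :\: (Lf :|: Rt)| <= 1)%N.
  have v i : i \in D :\: (Lf :|: Rt) -> px i = p.1.
    rewrite !inE negb_or => /andP[/andP[+ +] iD]; rewrite iD /= => h3 h4.
    by apply/eqP; rewrite eq_le !leNgt h4.
  by apply/card_le1_eqP => i j /v hi /v hj; apply: (vertical_eq pxI hj hi).
have := cardsU Lf Rt; have := cardsID (Lf :|: Rt) D.
have : (#|D :&: (Lf :|: Rt)| <= #|Lf :|: Rt|)%N by apply/subset_leq_card/subsetIr.
by lia.
Qed.

Let card_rest p L A B : fan p L A B ->
  #|D :\: (A :|: B)| = nC /\
  (#|A :&: X| + #|B :&: X| + #|(D :\: (A :|: B)) :&: X| = a + b + c)%N.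
Proof.
move=> [[AL LD BL cA cB] _].
have AD : A \subset D := subset_trans AL LD.
have BD : B \subset D := subset_trans BL (subsetDl _ _).
have dAB : [disjoint A & B].
  rewrite disjoint_subset; apply/subsetP => i /(subsetP AL) iL; rewrite inE.
  by apply/negP => /(subsetP BL); rewrite inE iL.
have sAB : A :|: B \subset D by rewrite subUset AD.
have cU : #|A :|: B| = (nA + nB)%N by rewrite cardsU (disjoint_setI0 dAB) cards0 cA cB subn0.
split; first by rewrite cardsDS // cU cD; lia.
rewrite -cX -(cardsID (A :|: B) (D :&: X)).
have -> : D :&: X :&: (A :|: B) = (A :&: X) :|: (B :&: X).
  rewrite -setIUl [RHS]setIC -setIA [X :&: _]setIC setIA.
  by rewrite (setIidPr sAB) setIC.
have -> : (D :&: X) :\: (A :|: B) = (D :\: (A :|: B)) :&: X.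
  by apply/setP => i; rewrite !inE; do !case: (i \in _).
rewrite cardsU; congr (_ + _)%N.
rewrite [in X in (_ - X)%N](_ : _ :&: _ = set0) ?cards0 ?subn0 //.
by apply/eqP; rewrite -subset0 -(disjoint_setI0 dAB) setISS // subsetIl.
Qed.

Definition three_cut : Prop := exists A B C : {set T},
  [/\ A :|: B :|: C = D, [disjoint A & B], [disjoint A & C] & [disjoint B & C]] /\
  [/\ #|A| = nA, #|B| = nB & #|C| = nC] /\
  [/\ #|A :&: X| = a, #|B :&: X| = b & #|C :&: X| = c] /\
  [/\ wsep px py A B, wsep px py A C & wsep px py B C].

Let legit_three_cut p L A B : fan p L A B -> legit px py D p L A B ->
  #|A :&: X| = a -> #|B :&: X| = b -> three_cut.
Proof.
move=> pf lg xa xb; exists A, B, (D :\: (A :|: B)).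
have [cC xC] := card_rest pf.
have [[AL LD BL cA cB] [lL rL _ _]] := pf.
split; [split|split; [by []|split; [by split=> //; lia|split]]].
- have sAB : A :|: B \subset D.
    by rewrite subUset (subset_trans AL LD) (subset_trans BL (subsetDl _ _)).
  by rewrite -{1}(setIidPr sAB) setID.
- rewrite disjoint_subset; apply/subsetP => i /(subsetP AL) iL; rewrite inE.
  by apply/negP => /(subsetP BL); rewrite inE iL.
- by rewrite disjoint_subset; apply/subsetP => i iA; rewrite !inE iA.
- by rewrite disjoint_subset; apply/subsetP => i iA; rewrite !inE iA orbT.
- exists (1, 0); first by rewrite xpair_eqE oner_eq0.
  move=> i j iA jB; rewrite /lin /= !mul1r !mul0r !addr0.
  apply: (@le_trans _ _ p.1); first exact/lL/(subsetP AL).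
  exact/rL/(subsetP BL).
- exact: (legit_wsep pxI nA0 nB0 pf lg).
- exact: (legit_wsep_right pxI nA0 nB0 pf lg).
Qed.

(** Label C comes from a legitimate fan without surplus in [A0] and [B0]. Its third part has no
    deficit, so it is no half-plane part and reflex fans are excluded at [p]. Degenerate apices
    contradict [hA] or [hB], so other fans at [p] have a surplus in [A] and in [B]; being one
    exchange away, they force equality in [A0] and [B0]. *)
Let three_labels p : weak_label p lA -> weak_label p lB -> weak_label p lC -> three_cut.
Proof.
move=> wA wB [[_ //]|[[_ //]|[L0 [A0 [B0 [pf0 [[lg0 l0]|[_ //]]]]]]]].
have [cC0 sX0] := card_rest pf0.
have cA0 : #|A0| = nA by have [[]] := pf0.
have cB0 : #|B0| = nB by have [[]] := pf0.
move: l0; rewrite /fan_label; case: ltnP => // b0; case: ltnP => // a0 _.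
have noC : ~ halfset px py D (D :\: (A0 :|: B0)).
  by move=> /hC /(_ cC0); move: sX0; lia.
have {wB} [fl|[L1 [A1 [B1 [pf1 b1]]]]] : few_left p \/
    exists L A B, fan p L A B /\ (b < #|B :&: X|)%N.
  case: wB => [[fl _]|[[_ //]|[L1 [A1 [B1 [pf1 [[lg1 l1]|[_ //]]]]]]]]; first by left.
  right; exists L1, A1, B1; split=> //; move: l1; rewrite /fan_label.
  by case: ltnP => // _; case: ifP.
  have aA L A B : fan p L A B -> (#|A :&: X| < a)%N.
    move=> pf; apply: hA; last by have [[]] := pf.
    exact: (few_left_halfset pxI nA0 nB0 pf).
  case: wA => [[_ //]|[[fr _]|[L2 [A2 [B2 [pf2 [[lg2 l2]|[rf _]]]]]]]].
  - by case: (few_left_right fl fr).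
  - move: l2; rewrite /fan_label; case: ltnP => // _; case: ltnP => // h.
    by have := aA _ _ _ pf2; lia.
  - by case: noC; apply: (reflex_halfset pxI nA0 nB0 pf0 pf2).
case: wA => [[_ //]|[[fr _]|[L2 [A2 [B2 [pf2 [[lg2 l2]|[rf _]]]]]]]].
- have hB1 := few_right_halfset pxI nA0 nB0 pf1 fr.
  have cB1 : #|B1| = nB by have [[]] := pf1.
  by have := hB hB1 cB1; lia.
- move: l2; rewrite /fan_label; case: ltnP => // _; case: ltnP => // a2 _.
  have := card_setI_swap X (prefan_swap nc pxI pf2 pf0).
  have := card_setI_swap X (prefan_swap_right nc pxI pf1 pf0) => h1 h2.
  by apply: (legit_three_cut pf0 lg0); lia.
- by case: noC; apply: (reflex_halfset pxI nA0 nB0 pf0 pf2).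
Qed.

(* Unlike [weak_label], this relation prefers the degenerate cases, which fixes the labels on
   the boundary of a large square. *)
Let strict_label p l : Prop :=
  if few_left p then l = lB else if few_right p then l = lA else
  exists L A B, fan p L A B /\
    ((legit px py D p L A B /\ l = fan_label A B) \/
     [/\ ~ legit px py D p L A B, reflex px py D p L A B & l = lA]).

Let strict_label_exists p : exists l, strict_label p l.
Proof.
rewrite /strict_label.
have [_|fl] := boolP (few_left p); first by exists lB.
have [_|fr] := boolP (few_right p); first by exists lA.
rewrite /few_left -leqNgt in fl; rewrite /few_right -leqNgt in fr.
have [L [A [B pf]]] := prefan_exists py pxI nA0 fl fr.
have [lg|nlg] := boolp.pselect (legit px py D p L A B).
  by exists (fan_label A B), L, A, B; split=> //; left.
exists lA, L, A, B; split=> //; right; split=> //.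
by case: (legit_or_reflex pxI nA0 nB0 pf).
Qed.

Let strict_label_weak p l : strict_label p l -> weak_label p l.
Proof.
rewrite /strict_label; case: ifPn => [fl ->|_]; first by left.
case: ifPn => [fr ->|_]; first by right; left.
move=> [L [A [B [pf H]]]]; right; right; exists L, A, B; split=> //.
by case: H => [[lg ->]|[_ rf ->]]; [left|right].
Qed.

Lemma three_cut_distinct : three_cut.
Proof.
have [lam lamP] := boolp.choice strict_label_exists.
(* All points lie inside the square, so an apex on its boundary has all of them on one side. *)
pose M : R := 1 + \sum_i (`|px i| + `|py i|).
have bound i : `|px i| + `|py i| < M.
  rewrite /M (bigD1 i) //=.
  have : 0 <= \sum_(j | j != i) (`|px j| + `|py j|) by apply: sumr_ge0 => j _; rewrite addr_ge0.
  lra.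
have boundx i : - M < px i < M.
  by rewrite -ltr_norml; have := bound i; have := normr_ge0 (py i); lra.
have boundy i : - M < py i < M.
  by rewrite -ltr_norml; have := bound i; have := normr_ge0 (px i); lra.
have M0 : 0 < M.
  by rewrite /M ltr_wpDr // sumr_ge0 // => j _; rewrite addr_ge0.
have [||||p Hp] := @sperner_square R refines lam M M0 refines_near.
- move=> y; have := lamP (- M, y); rewrite /strict_label /few_left /=.
  have -> : [set i in D | (px i < - M)%R] = set0.
    by apply/setP => i; rewrite !inE ltNge ltW ?andbF // (andP (boundx i)).1.
  by rewrite cards0 nA0.
- move=> y; have := lamP (M, y); rewrite /strict_label /few_left /few_right /=.
  have -> : [set i in D | (px i < M)%R] = D.
    by apply/setP => i; rewrite !inE (andP (boundx i)).2 andbT.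
  have -> : [set i in D | (M < px i)%R] = set0.
    by apply/setP => i; rewrite !inE ltNge ltW ?andbF // (andP (boundx i)).2.
  by rewrite cards0 nB0 cD ltnNge -addnA leq_addr.
(* From the top edge the third part is a half-plane part, hence has a deficit, while label C means
   no surplus in the other two. *)
- move=> x lC'; have := lamP (x, M); rewrite lC' /strict_label.
  case: ifP => // _; case: ifP => // _ [L [A [B [pf [[lg l]|[_ _ //]]]]]].
  have [cC sX] := card_rest pf.
  have := hC (high_apex_halfset pxI nA0 nB0 pf lg _) cC.
  move: l; rewrite /fan_label; case: ltnP => // h1; case: ltnP => // h2 _ h3.
  have : (#|(D :\: (A :|: B)) :&: X| < c)%N by apply: h3 => i _; case/andP: (boundy i).
  lia.
- have low i : i \in D -> - M < py i by move=> _; case/andP: (boundy i).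
  (* From the bottom edge [A] and [B] are half-plane parts without surplus, so labels A and B arise
     only from degenerate apices. *)
  have bottom x l : strict_label (x, - M) l ->
      [\/ few_left (x, - M) /\ l = lB, few_right (x, - M) /\ l = lA | l = lC].
    rewrite /strict_label; case: ifPn => [fl ->|_]; first by constructor 1.
    case: ifPn => [fr ->|_ [L [A [B [pf]]]]]; first by constructor 2.
    have cA : #|A| = nA by have [[]] := pf.
    have cB : #|B| = nB by have [[]] := pf.
    have xA := hA (low_apex_halfset pxI nA0 pf low) cA.
    have xB := hB (low_apex_halfset_right pxI nB0 pf low) cB.
    case=> [[_ ->]|[nlg _ _]]; last by case: nlg; apply: (low_apex_legit pf).
    by constructor 3; rewrite /fan_label !ltnNge (ltnW xA) (ltnW xB).
  move=> p x x' [rl rr _] [rl' rr' _] lx lx'.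
  have := bottom _ _ (lamP (x, - M)); have := bottom _ _ (lamP (x', - M)).
  rewrite lx lx' => -[[fl _]|[]//|//] [[]//|[fr _]|//].
  apply: (@few_left_right p).
  + apply: leq_ltn_trans fl; apply: subset_leq_card.
    by apply/subsetP => i; rewrite !inE => /andP[-> /rl'].
  + apply: leq_ltn_trans fr; apply: subset_leq_card.
    by apply/subsetP => i; rewrite !inE => /andP[-> /rr].
by apply: (@three_labels p); [have [q r <-] := Hp lA | have [q r <-] := Hp lB
  | have [q r <-] := Hp lC]; apply: weak_label_refines r _; apply/strict_label_weak/lamP.
Qed.

End DistinctAbscissae.
End ThreeCut.

(** * Two colours *)

Section Shear.
Variables (R : realType) (T : finType) (px py : T -> R).
Hypothesis nc : noncollinear px py.

(* With three points, noncollinearity makes the points distinct. *)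
Lemma exists_injective_shear : (2 < #|T|)%N ->
  exists e : R, injective (fun i => px i + e * py i).
Proof.
move=> T3.
pose bad (ij : T * T) := `|(px ij.2 - px ij.1) / (py ij.1 - py ij.2)|.
(* This exceeds every parameter at which two points of different ordinates get equal abscissae. *)
exists (1 + \sum_ij bad ij) => i j eij; apply/eqP; apply: contraT => ij.
have [yij|yij] := eqVneq (py i) (py j).
  have xij : px i = px j by move: eij; rewrite yij; lra.
  have [k] : exists k, k \notin [set i; j].
    apply/existsP; rewrite -negb_forall; apply/negP => /forallP h.
    have : (#|T| <= #|[set i; j]|)%N.
      by rewrite -cardsT; apply/subset_leq_card/subsetP => k _; apply: h.
    by rewrite cards2 ij; lia.
  rewrite !inE negb_or => /andP[ki kj].
  have := @nc i j k ij; rewrite /det -xij -yij !subrr !mul0r subrr eqxx.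
  by rewrite ![_ == k]eq_sym ki kj => /(_ isT isT).
have d0 : py i - py j != 0 by rewrite subr_eq0.
set e := 1 + _ in eij.
have ee : e = (px j - px i) / (py i - py j).
  by apply: (mulIf d0); rewrite divfK //; move: eij; lra.
have : bad (i, j) < e.
  rewrite /e (bigD1 (i, j)) //=.
  have : 0 <= \sum_(k | k != (i, j)) bad k by apply: sumr_ge0 => k _; apply: normr_ge0.
  lra.
by rewrite /bad /= -ee ltNge ler_norm.
Qed.

Lemma noncollinear_shear e : noncollinear (fun i => px i + e * py i) py.
Proof.
move=> i j k ij ik jk; rewrite (_ : det _ _ _ _ _ = det px py i j k); first exact: nc.
by rewrite /det; ring.
Qed.

Lemma lin_shear e (d : R * R) : d != (0, 0) ->
  exists2 d', d' != (0, 0) &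
    forall i, lin (fun i => px i + e * py i) py d i = lin px py d' i.
Proof.
move=> d0; exists (d.1, d.1 * e + d.2); last by move=> i; rewrite /lin /=; ring.
case: d d0 => u v; apply: contra; rewrite !xpair_eqE /= => /andP[/eqP ->].
by rewrite mul0r add0r eqxx.
Qed.

End Shear.

Section ThreeCutExists.
Variables (R : realType) (T : finType) (px py : T -> R).
Variables (D X : {set T}) (nA nB nC a b c : nat).
Hypothesis nc : noncollinear px py.

(** A shear makes the abscissae distinct, and separating directions are carried back by
    [lin_shear]. *)
Theorem three_cut_exists :
  (0 < nA)%N -> (0 < nB)%N -> (0 < nC)%N ->
  #|D| = (nA + nB + nC)%N -> #|D :&: X| = (a + b + c)%N ->
  (forall S, halfset px py D S -> #|S| = nA -> (#|S :&: X| < a)%N) ->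
  (forall S, halfset px py D S -> #|S| = nB -> (#|S :&: X| < b)%N) ->
  (forall S, halfset px py D S -> #|S| = nC -> (#|S :&: X| < c)%N) ->
  three_cut px py D X nA nB nC a b c.
Proof.
move=> nA0 nB0 nC0 cD cX hA hB hC.
have T3 : (2 < #|T|)%N by have := max_card (mem D); rewrite cD; lia.
have [e eI] := exists_injective_shear nc T3.
have chg := @lin_shear _ _ px py e.
have [|||A [B [C [h1 [h2 [h3 [w1 w2 w3]]]]]]] :=
  three_cut_distinct (noncollinear_shear nc e) nA0 nB0 cD cX _ _ _ eI.
- by move=> S /(halfset_change chg); apply: hA.
- by move=> S /(halfset_change chg); apply: hB.
- by move=> S /(halfset_change chg); apply: hC.
by exists A, B, C; split=> //; split=> //; split=> //; split; apply: (wsep_change chg).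
Qed.

End ThreeCutExists.

(** * Families of pairwise separated [k]-sets *)

Section Parts.
Variables (R : realType) (T : finType) (px py : T -> R) (k : nat).
Implicit Types (D S X : {set T}) (good : {set T} -> Prop).

Definition separated S S' : bool := [disjoint S & S'] && boolp.asbool (wsep px py S S').

Definition separated_parts good D n : Prop := exists2 s : seq {set T},
  size s = n /\ pairwise separated s &
  forall S, S \in s -> [/\ S \subset D, #|S| = k & good S].

Lemma separatedS D1 D2 S1 S2 : S1 \subset D1 -> S2 \subset D2 ->
  separated D1 D2 -> separated S1 S2.
Proof.
move=> s1 s2 /andP[dD /boolp.asboolP wD]; apply/andP; split.
  by apply: disjointWl s1 _; apply: disjointWr s2 _.
by apply/boolp.asboolP; apply: wsepS wD.
Qed.

Lemma separated_parts_single good D : #|D| = k -> good D -> separated_parts good D 1.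
Proof. by move=> cD gD; exists [:: D] => // S; rewrite inE => /eqP ->. Qed.

Lemma separated_parts0 good D : separated_parts good D 0.
Proof. by exists [::]. Qed.

Lemma separated_parts_sub (good good' : {set T} -> Prop) D n :
  (forall S, S \subset D -> good S -> good' S) ->
  separated_parts good D n -> separated_parts good' D n.
Proof.
move=> H [s h1 h2]; exists s => // S /h2 [SD cS gS]; split=> //; exact: H.
Qed.

Lemma separated_parts_cat good D D1 D2 n1 n2 :
  D1 \subset D -> D2 \subset D -> separated D1 D2 ->
  separated_parts good D1 n1 -> separated_parts good D2 n2 ->
  separated_parts good D (n1 + n2).
Proof.
move=> s1D s2D sep [s1 [c1 p1] h1] [s2 [c2 p2] h2]; exists (s1 ++ s2).
  rewrite size_cat c1 c2 pairwise_cat p1 p2 !andbT; split=> //.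
  apply/allrelP => S S' /h1 [S1 _ _] /h2 [S2 _ _]; exact: separatedS sep.
move=> S; rewrite mem_cat => /orP[/h1|/h2] [sS cS gS]; split=> //.
  exact: subset_trans sS s1D.
exact: subset_trans sS s2D.
Qed.

Lemma separated_parts_cat3 good D D1 D2 D3 n1 n2 n3 :
  D1 \subset D -> D2 \subset D -> D3 \subset D ->
  separated D1 D2 -> separated D1 D3 -> separated D2 D3 ->
  separated_parts good D1 n1 -> separated_parts good D2 n2 -> separated_parts good D3 n3 ->
  separated_parts good D (n1 + (n2 + n3)).
Proof.
move=> s1D s2D s3D s12 s13 s23 [s1 [c1 p1] h1] [s2 [c2 p2] h2] [s3 [c3 p3] h3].
exists (s1 ++ (s2 ++ s3)).
  rewrite !size_cat c1 c2 c3 !pairwise_cat p1 p2 p3 !andbT; split=> //.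
  apply/andP; split; apply/allrelP => S S'; last first.
    by move=> /h2 [S1 _ _] /h3 [S2 _ _]; exact: separatedS s23.
  move=> /h1 [S1 _ _]; rewrite mem_cat => /orP[/h2|/h3] [S2 _ _].
    exact: separatedS s12.
  exact: separatedS s13.
move=> S; rewrite !mem_cat => /or3P[/h1|/h2|/h3] [sS cS gS]; split=> //.
- exact: subset_trans sS s1D.
- exact: subset_trans sS s2D.
- exact: subset_trans sS s3D.
Qed.

Lemma halfset_separated D S : halfset px py D S -> separated S (D :\: S).
Proof.
move=> [SD w]; apply/andP; split; last exact/boolp.asboolP.
by rewrite disjoint_subset; apply/subsetP => i iS; rewrite !inE iS.
Qed.

End Parts.

Section TwoColors.
Variables (R : realType) (T : finType) (px py : T -> R) (k : nat).
Hypothesis nc : noncollinear px py.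
Hypothesis k2 : (2 <= k)%N.
Implicit Types (D S X : {set T}).

Definition bicolored X S : Prop := S :&: X != set0 /\ S :\: X != set0.

Lemma bicoloredC X S : bicolored (~: X) S -> bicolored X S.
Proof. by rewrite /bicolored !setDE setCK => -[]. Qed.

Section Step.
Variables (n : nat) (D X : {set T}).
Hypothesis n2 : (2 <= n)%N.
Hypothesis cD : #|D| = (k * n)%N.
Hypotheses (nX : (n <= #|D :&: X|)%N) (Xn : (2 * #|D :&: X| <= k * n)%N).
Local Notation B := #|D :&: X|.
(* No line splits off [k * i] points leaving at least as many points of each colour as
   parts on both sides. *)
Hypothesis nocut : forall i S, halfset px py D S -> #|S| = (k * i)%N -> (0 < i < n)%N ->
  (i <= #|S :&: X|)%N -> (#|S :&: X| + i <= k * i)%N -> (#|S :&: X| + n <= B + i)%N ->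
  (k * i + B + n <= k * n + #|S :&: X| + i)%N -> False.

Let cardX_diff S : S \subset D -> (#|S :&: X| + #|(D :\: S) :&: X| = B)%N.
Proof.
move=> SD; rewrite -(cardsID S (D :&: X)); congr (_ + _)%N.
  by rewrite setIAC (setIidPr SD).
by rewrite setIDAC.
Qed.

(** This is [(k - 2) * (v - u) >= 0] without subtraction. *)
Let slack u v : (u <= v)%N -> (2 * v + k * u <= k * v + 2 * u)%N.
Proof. by move=> uv; have := leq_mul k2 (leqnn (v - u)); have := leq_mul (leqnn k) uv; nia. Qed.

Let slack2 : (2 * n + 2 * k <= k * n + 4)%N.
Proof. nia. Qed.

(* Along a fixed direction the number of points of [X] cannot jump over the admissible
   window from above, since it is nondecreasing. *)
Lemma sweep i d S : (0 < i)%N -> (2 * i <= n)%N -> d != (0, 0) ->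
  lowest D (lin px py d) S -> #|S| = (k * i)%N -> (i <= #|S :&: X|)%N ->
  forall j, (i <= j)%N -> (j <= n - i)%N ->
  exists S', [/\ lowest D (lin px py d) S', #|S'| = (k * j)%N, (j <= #|S' :&: X|)%N &
    (k * j + B + n <= k * n + #|S' :&: X| + j)%N].
Proof.
move=> i0 i2 d0 lS cS iS j; elim: j => [|j IH] ij jn; first by lia.
have [ij'|ij'] := ltnP j i.
  have -> : j.+1 = i by lia.
  exists S; split=> //.
  have := slack i2; lia.
have [S' [lS' cS' jS' hS']] := IH ij' (ltnW jn).
have kj : (k * j.+1 <= k * n)%N by rewrite leq_mul2l; lia.
have [|S'' [lS'' sub cS'']] := @lowest_extend _ _ D _ S' (k * j.+1) lS'.
  by rewrite cS' cD kj leq_mul2l leqnSn orbT.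
have mono : (#|S' :&: X| <= #|S'' :&: X|)%N by apply/subset_leq_card/setSI.
(* The two lower bounds of the window hold at [j], so an upper one fails; the count is then large
   enough for both lower bounds at [j + 1]. *)
have no : ~ ((#|S' :&: X| + j <= k * j)%N /\ (#|S' :&: X| + n <= B + j)%N).
  move=> [h1 h2]; apply: (nocut (lowest_halfset d0 lS') cS') => //; lia.
have kj2 : (2 * j <= k * j)%N by rewrite leq_mul2r k2 orbT.
have jn' : (j.+1 <= n)%N by lia.
have := slack jn'; have := slack2; rewrite mulnS in kj cS'' *.
exists S''; split=> //; rewrite ?mulnS; lia.
Qed.

(** If [S] were heavy, a sweep to [n - i] in its direction would leave a light complement of the
    same size [k * i]. Rotating [S] into that complement changes the count by at most one at a time,
    so the value [i] would occur, and that is a cut. *)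
Lemma light_halfset i S : (0 < i)%N -> (2 * i <= n)%N ->
  halfset px py D S -> #|S| = (k * i)%N -> (#|S :&: X| < i)%N.
Proof.
move=> i0 i2 hS cS; rewrite ltnNge; apply/negP => iS.
have [SD [d d0 hd]] := hS.
have slk := slack i2.
have [||S' [lS' cS' jS' hS']] := @sweep i d S i0 i2 d0 (conj SD hd) cS iS (n - i); [lia|lia|].
have hS1 := lowest_halfset d0 lS'.
have hS2 := halfsetC hS1; have [S'D _] := hS1.
have cX' := cardX_diff S'D.
have kni : (k * (n - i) = k * n - k * i)%N by rewrite mulnBr.
have le_ki : (2 * i <= k * i)%N by rewrite leq_mul2r k2 orbT.
have le_kn : (k * i <= k * n)%N by rewrite leq_mul2l; lia.
have c2 : #|D :\: S'| = (k * i)%N by rewrite cardsDS // cD cS' kni; lia.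
have light : (#|(D :\: S') :&: X| < i)%N.
  rewrite ltnNge; apply/negP => h.
  by apply: (nocut hS1 cS'); rewrite ?kni in hS' *; lia.
suff : (i <= #|(D :\: S') :&: X|)%N by lia.
apply: (halfset_rotate nc (Q := fun S => (i <= #|S :&: X|)%N) _ _ hS hS2 cS c2 iS).
  by rewrite cD.
move=> S1 S2 h1 h2 c1 c2' sw iS1; have := card_setI_swap X sw.
suff : #|S1 :&: X| <> i by lia.
by move=> e; apply: (nocut h1 c1); rewrite ?e; lia.
Qed.

Let exists_halfset m : (m <= k * n)%N -> exists2 S, halfset px py D S & #|S| = m.
Proof.
rewrite -cD => mD; have [S lS cS] := lowest_exists (lin px py (1, 0)) mD.
by exists S => //; apply: lowest_halfset lS; rewrite xpair_eqE oner_eq0.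
Qed.

Lemma odd_three_cut : exists h a b c,
  [/\ n = (h + (h + 1))%N, (0 < h)%N, (a + b + c = B)%N &
      three_cut px py D X (k * h) (k * h) (k * 1) a b c] /\
  [/\ (h <= a)%N /\ (a + h <= k * h)%N, (h <= b)%N /\ (b + h <= k * h)%N
    & (1 <= c)%N /\ (c + 1 <= k * 1)%N].
Proof.
pose h := n./2.
have nE : n = (odd n + 2 * h)%N by rewrite mul2n odd_double_half.
have h0 : (0 < h)%N by rewrite half_gt0.
have hn : (2 * h <= n)%N by lia.
(* For even [n] two complementary halves would both be light, leaving fewer than [n] points of
   [X]. *)
have odd_n : odd n.
  apply: contraT => /negbTE on; rewrite on add0n in nE.
  have kh : (k * h <= k * n)%N by rewrite leq_mul2l; lia.
  have [S hS cS] := exists_halfset kh; have [SD _] := hS.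
  have l1 := light_halfset h0 hn hS cS.
  have := cardX_diff SD; have : (#|(D :\: S) :&: X| < h)%N.
    apply: light_halfset => //; first exact: halfsetC.
    by rewrite cardsDS // cD cS {1}nE; lia.
  lia.
rewrite odd_n in nE.
have le_kh : (2 * h <= k * h)%N by rewrite leq_mul2r k2 orbT.
have kn : (k * n = 2 * (k * h) + k)%N by rewrite nE; lia.
(* The targets start from [h], [h], [1], and the excess [B - n] goes first to [a] and then to [b],
   each up to [(k - 1) * h]. Since [X] is a minority, all of it fits and the third target is 1. *)
pose a := (h + minn (k * h - 2 * h) (B - n))%N.
pose b := (h + minn (k * h - 2 * h) (B - n - (a - h)))%N.
exists h, a, b, (B - a - b)%N; split; split; rewrite ?muln1; try (rewrite /b /a; lia).
apply: (@three_cut_exists _ _ _ _ _ _ _ _ _ _ _ (B - a - b) nc); try (rewrite ?muln1 /b /a; lia).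
- move=> S hS cS; apply: (@leq_trans h); last by rewrite /a; lia.
  exact: light_halfset hS cS.
- move=> S hS cS; apply: (@leq_trans h); last by rewrite /b; lia.
  exact: light_halfset hS cS.
- move=> S hS cS; apply: (@leq_trans 1); last by rewrite /b /a; lia.
  by apply: light_halfset hS _ => //; rewrite ?cS ?muln1.
Qed.

End Step.

Theorem bicolored_parts n D X : #|D| = (k * n)%N ->
  (n <= #|D :&: X|)%N -> (n <= #|D :\: X|)%N ->
  separated_parts px py k (bicolored X) D n.
Proof.
elim/ltn_ind: n D X => n IH D X.
wlog minor : X / (2 * #|D :&: X| <= k * n)%N.
  move=> wl cD nX nY; have [h|h] := leqP (2 * #|D :&: X|) (k * n); first exact: wl.
  apply: (separated_parts_sub (good := bicolored (~: X))) => [S _|]; first exact: bicoloredC.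
  have e1 : D :\: X = D :&: ~: X by rewrite setDE.
  have e2 : D :\: ~: X = D :&: X by rewrite setDE setCK.
  apply: wl; rewrite ?e2 // -?e1 //.
  have := cardsID X D; lia.
move=> cD nX nY.
have [n0|n1|n2] := ltngtP n 1.
- have -> : n = 0%N by lia.
  exact: separated_parts0.
- have cDX := cardsID X D.
  (* Assuming that no parts exist yields [nocut], because a cut would give parts by induction. *)
  apply: boolp.contrapT => nparts.
  have cut i (A : {set T}) : A \subset D -> #|A| = (k * i)%N -> (i <= #|A :&: X|)%N ->
      (#|A :&: X| + i <= k * i)%N -> (i < n)%N -> separated_parts px py k (bicolored X) A i.
    move=> AD cA h1 h2 h3; apply: IH => //.
    by have := cardsID X A; lia.
  have [|h [a [b [c [[nE h0 abc tc] [[a1 a2] [b1 b2] [c1 c2]]]]]]] :=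
      odd_three_cut n1 cD nX minor.
    move=> i S hS cS /andP[i0 iN] h1 h2 h3 h4; apply: nparts.
    have [SD _] := hS.
    have -> : n = (i + (n - i))%N by lia.
    have le_kn : (k * i <= k * n)%N by rewrite leq_mul2l; lia.
    have e1 : #|D :\: S| = (k * (n - i))%N by rewrite cardsDS // mulnBr cD cS.
    have e2 : (#|S :&: X| + #|(D :\: S) :&: X| = #|D :&: X|)%N.
      rewrite -[RHS](cardsID S (D :&: X)) setIAC (setIidPr SD); congr (_ + _)%N.
      by rewrite setIDAC.
    apply: (separated_parts_cat SD (subsetDl _ _) (halfset_separated hS)).
      exact: cut.
    by apply: cut => //; rewrite ?subsetDl ?mulnBr; lia.
  have [A [B0 [C [[dU dAB dAC dBC] [[cA cB cC] [[xa xb xc] [wAB wAC wBC]]]]]]] := tc.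
  apply: nparts; rewrite nE.
  have AD : A \subset D by rewrite -dU -setUA subsetUl.
  have BD : B0 \subset D by rewrite -dU setUAC subsetUr.
  have CD : C \subset D by rewrite -dU subsetUr.
  apply: (separated_parts_cat3 AD BD CD).
  + by rewrite /separated dAB; apply/boolp.asboolP.
  + by rewrite /separated dAC; apply/boolp.asboolP.
  + by rewrite /separated dBC; apply/boolp.asboolP.
  + by apply: cut; rewrite ?xa //; lia.
  + by apply: cut; rewrite ?xb ?cB //; lia.
  + by apply: cut; rewrite ?xc //; lia.
- rewrite n2 in cD nX nY *; apply: separated_parts_single; first by rewrite cD muln1.
  by split; rewrite -card_gt0.
Qed.

End TwoColors.

(** * Several colours *)

Section ManyColors.
Variables (R : realType) (T K : finType) (px py : T -> R) (col : T -> K).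
Hypothesis nc : noncollinear px py.
Implicit Types (D S : {set T}) (c : K).

Definition colored c : {set T} := [set i | col i == c].

Definition polychromatic S : Prop :=
  exists i j, [/\ i \in S, j \in S & col i != col j].

Lemma bicolored_polychromatic (J : {set K}) S :
  bicolored [set i | col i \in J] S -> polychromatic S.
Proof.
move=> [/set0Pn [i iX] /set0Pn [j jX]]; move: iX jX; rewrite !inE.
move=> /andP[iS iJ] /andP[jJ jS]; exists i, j; split=> //.
by apply: contraNneq jJ => <-.
Qed.

Lemma card_colored2 S c c' : c != c' ->
  (#|S :&: colored c| + #|S :&: colored c'| <= #|S|)%N.
Proof.
move=> cc'; rewrite -(cardsID (colored c) S) leq_add2l.
apply/subset_leq_card/subsetP => i; rewrite !inE => /andP[-> /eqP ->].
by rewrite eq_sym cc'.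
Qed.

Lemma card_coloredD S S' c : S' \subset S ->
  (#|S' :&: colored c| + #|(S :\: S') :&: colored c| = #|S :&: colored c|)%N.
Proof.
move=> SS; rewrite -(cardsID S' (S :&: colored c)); congr (_ + _)%N.
  by rewrite setIAC (setIidPr SS).
by rewrite setIDAC.
Qed.

(** One class with [n] points suffices. If there is none, a minimal [J] with at least [n] points has
    fewer than [2 * n], and [k >= 3] leaves [n] points outside. *)
Lemma merge_colors k n D : (3 <= k)%N -> (0 < n)%N -> #|D| = (k * n)%N ->
  (forall c, #|D :&: colored c| + n <= k * n)%N ->
  exists J : {set K}, (n <= #|D :&: [set i | col i \in J]|)%N /\
    (n <= #|D :\: [set i | col i \in J]|)%N.
Proof.
move=> k3 n0 cD hc; pose X (J : {set K}) := [set i | col i \in J].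
have X1 c : X [set c] = colored c by apply/setP => i; rewrite !inE.
suff [J h1 h2] : exists2 J, (n <= #|D :&: X J|)%N & (#|D :&: X J| + n <= k * n)%N.
  by exists J; split=> //; rewrite -/(X J); have := cardsID (X J) D; lia.
have [/existsP [c hn]|small] := boolP [exists c, n <= #|D :&: colored c|]%N.
  by exists [set c]; rewrite X1.
have {}small c : (#|D :&: colored c| < n)%N.
  by rewrite ltnNge; apply: contra small => h; apply/existsP; exists c.
have PT : (n <= #|D :&: X setT|)%N.
  rewrite (_ : X setT = setT) ?setIT ?cD; last by apply/setP => i; rewrite !inE.
  by rewrite -{1}(mul1n n) leq_mul2r; lia.
have [J nJ Jmin] := arg_minnP (fun J : {set K} => #|J|) (PT : (fun J => n <= #|D :&: X J|)%N setT).
exists J => //.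
have [c cJ] : exists c, c \in J.
  apply/set0Pn; apply: contraTneq nJ => ->; rewrite -ltnNge.
  rewrite (_ : X set0 = set0) ?setI0 ?cards0 //; by apply/setP => i; rewrite !inE.
have lt : (#|D :&: X (J :\ c)| < n)%N.
  rewrite ltnNge; apply/negP => /Jmin; rewrite (cardsD1 c J) cJ; lia.
have := small c.
have : (#|D :&: X J| <= #|(D :&: X (J :\ c)) :|: (D :&: colored c)|)%N.
  apply/subset_leq_card/subsetP => i; rewrite !inE => /andP[-> ->].
  by case: eqP.
have := cardsU (D :&: X (J :\ c)) (D :&: colored c).
have : (3 * n <= k * n)%N by rewrite leq_mul2r k3 orbT.
by lia.
Qed.

Lemma lowest_chain D (key : T -> R) n : #|D| = (2 * n)%N ->
  exists f : nat -> {set T},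
    (forall j, (j <= n)%N -> lowest D key (f j) /\ #|f j| = (2 * j)%N) /\
    (forall j j', (j <= j')%N -> (j' <= n)%N -> f j \subset f j').
Proof.
move=> cD; suff [f [h1 h2]] : exists f : nat -> {set T},
    (forall j, (j <= n)%N -> lowest D key (f j) /\ #|f j| = (2 * j)%N) /\
    (forall j, (j < n)%N -> f j \subset f j.+1).
  exists f; split=> // j j' /subnK <-; elim: (j' - j)%N => [//|d IH] dn.
  apply: subset_trans (IH (ltnW dn)) _; exact: h2.
elim: {-2}n (leqnn n) => [|N IH] Nn.
  exists (fun=> set0); split=> // j; rewrite leqn0 => /eqP ->.
  by rewrite cards0; split=> //; apply: lowest0.
have [f [h1 h2]] := IH (ltnW Nn); have [lN cN] := h1 N (leqnn N).
have [|S [lS sub cS]] := @lowest_extend _ _ D key (f N) (2 * N.+1) lN.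
  by rewrite cN cD; lia.
exists (fun j => if (j <= N)%N then f j else S); split=> j hj.
  case: leqP => [|h]; first exact: h1.
  by have -> : j = N.+1 by lia.
rewrite -ltnS hj; case: ltnP => [h|h]; first exact: h2.
by have -> : j = N by lia.
Qed.

(* When all pairs cut off by a line have the same colour [c0], sweep in pairs until [c0]
   loses its majority, after [j] pairs; if some colour [x] then has a majority among the
   remaining points, continue to the first [j'] where it loses it. *)
Lemma pairs_parts n D : #|D| = (2 * n)%N -> (forall c, #|D :&: colored c| <= n)%N ->
  separated_parts px py 2 polychromatic D n.
Proof.
elim/ltn_ind: n D => n IH D cD hc.
(* A colour with exactly [n] points, against all the others, is the case of two colours. *)
have [/existsP [c /eqP cn]|neq] := boolP [exists c, #|D :&: colored c| == n].
  apply: (separated_parts_sub (good := bicolored (colored c))).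
    move=> S _ bS; apply: (bicolored_polychromatic (J := [set c])).
    by rewrite (_ : [set i | _] = colored c) //; apply/setP => i; rewrite !inE.
  apply: bicolored_parts => //; rewrite ?cn //.
  by have := cardsID (colored c) D; lia.
have {neq} lt c : (#|D :&: colored c| < n)%N.
  rewrite ltn_neqAle hc andbT; apply: contra neq => h; by apply/existsP; exists c.
have [n0|n0] := posnP n; first by rewrite n0; apply: separated_parts0.
have n2 : (2 <= n)%N.
  have [i iD] : exists i, i \in D by apply/card_gt0P; rewrite cD; lia.
  apply: leq_ltn_trans (lt (col i)); apply/card_gt0P.
  by exists i; rewrite !inE iD eqxx.
apply: boolp.contrapT => nparts.
have nocut j S : halfset px py D S -> #|S| = (2 * j)%N -> (0 < j < n)%N ->
    (forall c, #|S :&: colored c| <= j)%N ->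
    (forall c, #|D :&: colored c| + j <= n + #|S :&: colored c|)%N -> False.
  move=> hS cS /andP[j0 jn] h1 h2; apply: nparts; have [SD _] := hS.
  have -> : n = (j + (n - j))%N by lia.
  apply: (separated_parts_cat SD (subsetDl _ _) (halfset_separated hS)).
    by apply: IH => //; lia.
  apply: IH => [|//|c]; first by lia.
    by rewrite cardsDS // cD cS; lia.
  by have := h2 c; have := card_coloredD c SD; lia.
have mono S i j : halfset px py D S -> #|S| = 2%N -> i \in S -> j \in S -> col i = col j.
  move=> hS cS iS jS; apply/eqP; apply: contraT => ij.
  have neq_ij : i != j by apply: contraNneq ij => ->.
  case: (nocut 1%N S hS cS) => // c; last by have := lt c; lia.
  have ES : S = [set i; j].
    apply/esym/eqP; rewrite eqEcard cS cards2 neq_ij leqnn andbT.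
    by apply/subsetP => x; rewrite !inE => /orP[] /eqP ->.
  rewrite leqNgt; apply/negP => h.
  have : S :&: colored c == S by rewrite eqEcard subsetIl cS.
  move/eqP/setP => E; move: (E i) (E j); rewrite !inE iS jS /= => /eqP e1 /eqP e2.
  by move: ij; rewrite e1 e2 eqxx.
have d0 : (1, 0) != (0, 0) :> R * R by rewrite xpair_eqE oner_eq0.
have [f [lf fS]] := lowest_chain (lin px py (1, 0)) cD.
have hf j : (j <= n)%N -> halfset px py D (f j).
  by move=> /lf [h _]; apply: lowest_halfset d0 h.
have cf j : (j <= n)%N -> #|f j| = (2 * j)%N by move=> /lf [].
have fn : f n = D.
  by apply/eqP; rewrite eqEcard cf // cD leqnn andbT; case: (hf n (leqnn n)).
pose g c j := #|f j :&: colored c|.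
have g_two c c' j j' : c != c' -> (j <= j')%N -> (j' <= n)%N ->
    (g c j' + g c' j' + 2 * j <= g c j + g c' j + 2 * j')%N.
  move=> cc jj jn; have sub := fS _ _ jj jn.
  have := card_colored2 (f j' :\: f j) cc.
  rewrite cardsDS // !cf //; last exact: leq_trans jn.
  have := card_coloredD c sub; have := card_coloredD c' sub; rewrite /g; lia.
have g_mono c j j' : (j <= j')%N -> (j' <= n)%N -> (g c j <= g c j')%N.
  by move=> jj jn; apply/subset_leq_card/setSI/fS.
have g_step c j : (j < n)%N -> (g c j.+1 <= g c j + 2)%N.
  move=> jn; have := card_coloredD c (fS _ _ (leqnSn j) jn).
  have := subset_leq_card (subsetIl (f j.+1 :\: f j) (colored c)).
  rewrite cardsDS ?fS // !cf //; last exact: ltnW.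
  by rewrite /g; lia.
have gn c : (g c n < n)%N by rewrite /g fn.
have g0 c : g c 0 = 0%N.
  by apply/eqP; rewrite -leqn0; have := subset_leq_card (subsetIl (f 0) (colored c)); rewrite cf.
have n1 : (1 <= n)%N by lia.
have [i0 i0f] : exists i, i \in f 1 by apply/card_gt0P; rewrite cf.
pose c0 := col i0.
have all_c0 S : halfset px py D S -> #|S| = 2%N -> #|S :&: colored c0| = 2%N.
  move=> hS cS.
  (* Pairs that are one exchange apart share a point, so rotation carries the colour [c0] to every
     pair cut off by a line. *)
  have QS : forall i, i \in S -> col i = c0.
    apply: (halfset_rotate nc (Q := fun S => forall i, i \in S -> col i = c0) _ _
              (hf 1%N n1) hS (cf _ n1) cS).
    - by rewrite cD; lia.
    - move=> S1 S2 h1 h2 c1 c2 sw Q1 i iS2.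
      have [j] : exists j, j \in S1 :&: S2.
        by apply/card_gt0P; have := cardsID S2 S1; lia.
      rewrite inE => /andP[jS1 jS2]; rewrite -(Q1 _ jS1).
      exact: mono h2 c2 iS2 jS2.
    - by move=> i i1; apply: mono (hf _ n1) (cf _ n1) i1 i0f.
  rewrite -cS; congr #|pred_of_set _|; apply/setP => i; rewrite !inE.
  by case: (boolP (i \in S)) => [iS|//]; rewrite QS // eqxx.
have g1 : g c0 1%N = 2%N by apply: all_c0; [apply: hf|rewrite cf].
have nS : (n.-1 < n)%N by lia.
have gl : (g c0 n = g c0 n.-1 + 2)%N.
  have e : #|(D :\: f n.-1) :&: colored c0| = 2%N.
    apply: all_c0; first by apply/halfsetC/hf/ltnW.
    by rewrite -fn cardsDS ?fS ?leq_pred // !cf ?leq_pred //; lia.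
  by have := card_coloredD c0 (fS _ _ (ltnW nS) (leqnn n)); rewrite fn e /g fn; lia.
(* The witness [n - 1] works because [c0] has fewer than [n] points and the last pair has colour
   [c0]. *)
have ex1 : exists j, (0 < j)%N && (g c0 j <= j)%N.
  by exists n.-1; have := gn c0; lia.
have [j /andP[j0 gj] jmin] := ex_minnP ex1.
have jn : (j < n)%N.
  apply: leq_ltn_trans (nS); apply: jmin; have := gn c0; lia.
have j1 : j <> 1%N by move=> e; move: gj; rewrite e g1.
have gjE : g c0 j = j.
  have : ~~ (g c0 j.-1 <= j.-1)%N.
    by apply/negP => h; have : (j <= j.-1)%N by [apply: jmin; rewrite h andbT; lia]; lia.
  have := @g_mono c0 j.-1 j (leq_pred j) (ltnW jn); lia.
have left_j y : (g y j <= j)%N.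
  have [->|yc] := eqVneq y c0; first by rewrite gjE.
  by have := @g_two y c0 0%N j yc isT (ltnW jn); rewrite !g0 gjE; lia.
have [x hx] : exists x, (n + g x j < g x n + j)%N.
  apply: boolp.contrapT => nx; apply: (nocut j (f j)) => //; rewrite ?cf ?j0 ?(ltnW jn) //.
    exact/hf/ltnW.
  by move=> c; rewrite leqNgt; apply/negP => h; apply: nx; exists c; rewrite /g fn.
have xc0 : x != c0 by apply/eqP => e; move: hx; rewrite e gjE; have := gn c0; lia.
have ex2 : exists j', (j <= j')%N && (g x n + j' <= n + g x j')%N.
  exists n.-1; have := @g_two x c0 n.-1 n xc0 (ltnW nS) (leqnn n).
  by have := @g_mono x n.-1 n (ltnW nS) (leqnn n); lia.
have [j' /andP[jj' gj'] jmin'] := ex_minnP ex2.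
have jn' : (j' < n)%N.
  apply: leq_ltn_trans (nS); apply: jmin'.
  have := @g_two x c0 n.-1 n xc0 (ltnW nS) (leqnn n).
  by have := @g_mono x n.-1 n (ltnW nS) (leqnn n); lia.
have jlt : j != j' by apply/eqP => e; move: gj' hx; rewrite -e; lia.
(* Equality at the first [j']: one more pair adds at most two points of colour [x]. *)
have gj'E : (g x n + j' = n + g x j')%N.
  have : ~~ (g x n + j'.-1 <= n + g x j'.-1)%N.
    by apply/negP => h; have : (j' <= j'.-1)%N by [apply: jmin'; rewrite h andbT; lia]; lia.
  have := @g_step x j'.-1; rewrite prednK; last by lia.
  by move=> /(_ (ltnW jn')); lia.
apply: (nocut j' (f j')) => //; rewrite ?cf ?(ltnW jn') //.
- exact/hf/ltnW.
- by lia.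
(* Between [j] and [j'] colour [x] takes more than half of the points, so any other colour gains
   less than [j' - j]. *)
- move=> y; rewrite -/(g y j'); have [->|yx] := eqVneq y x; first by have := gn x; lia.
  by have := @g_two y x j j' yx jj' (ltnW jn'); have := left_j y; lia.
- move=> y; rewrite -{1}fn -/(g y n) -/(g y j').
  have [->|yx] := eqVneq y x; first by lia.
  by have := @g_two y x j' n yx (ltnW jn') (leqnn n); lia.
Qed.

Theorem polychromatic_parts k n D : (2 <= k)%N -> #|D| = (k * n)%N ->
  (forall c, #|D :&: colored c| + n <= k * n)%N ->
  separated_parts px py k polychromatic D n.
Proof.
move=> k2 cD hc; have [n0|n0] := posnP n; first by rewrite n0; apply: separated_parts0.
have [k3|k3] := ltnP 2 k.
  have [J [h1 h2]] := merge_colors k3 n0 cD hc.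
  apply: (separated_parts_sub _ (bicolored_parts nc k2 cD h1 h2)) => S _.
  exact: bicolored_polychromatic.
have k2E : k = 2%N by lia.
rewrite k2E in cD hc *; apply: pairs_parts => // c; have := hc c; lia.
Qed.

End ManyColors.

(** * Counting points in the given tuples *)

Lemma disjoint_cover (T : finType) n k (F : 'I_n -> {set T}) :
  (forall i, #|F i| = k) -> (forall i j, i != j -> [disjoint F i & F j]) ->
  #|T| = (k * n)%N -> forall x, exists i, x \in F i.
Proof.
move=> cF dF cT x.
suff : x \in \bigcup_i F i by move=> /bigcupP [i _ xi]; exists i.
suff -> : \bigcup_i F i = [set: T] by rewrite inE.
apply/eqP; rewrite eqEcard subsetT cardsT cT -sum1_card.
rewrite partition_disjoint_bigcup // (eq_bigr (fun=> k)) => [|i _]; last by rewrite sum1_card.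
by rewrite /= sum_nat_const card_ord [(n * k)%N]mulnC.
Qed.

Lemma card_color_class (T K : finType) n k (col : T -> K) (F : 'I_n -> {set T}) :
  (forall x, exists i, x \in F i) ->
  (forall i, #|F i| = k) -> (forall i, polychromatic col (F i)) ->
  forall c, (#|[set: T] :&: colored col c| + n <= k * n)%N.
Proof.
move=> cov cF pF c; rewrite setTI.
have small i : (#|F i :&: colored col c| + 1 <= k)%N.
  have [x [y [xF yF xy]]] := pF i.
  have [z zF zc] : exists2 z, z \in F i & col z != c.
    have [e|ne] := eqVneq (col x) c; last by exists x.
    by exists y => //; rewrite eq_sym -e.
  rewrite addn1 -(cF i); apply: proper_card; apply/properP; split; first exact: subsetIl.
  by exists z => //; rewrite !inE (negbTE zc) andbF.
have sum : (#|colored col c| <= \sum_(i < n) #|F i :&: colored col c|)%N.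
  apply: (@leq_trans #|\bigcup_i (F i :&: colored col c)|).
    apply/subset_leq_card/subsetP => x xc; have [i xi] := cov x.
    by apply/bigcupP; exists i => //; rewrite inE xi.
  elim/big_rec2: _ => [|i u v _ h]; first by rewrite cards0.
  by apply: leq_trans (leq_card_setU _ _) _; rewrite leq_add2l.
apply: leq_trans (_ : (\sum_(i < n) (#|F i :&: colored col c| + 1) <= _)%N).
  by rewrite big_split /= sum_nat_const card_ord muln1 leq_add2r.
rewrite mulnC -[X in (_ <= X * _)%N]card_ord -sum_nat_const; exact: leq_sum.
Qed.

(** * From weak to strict separation *)

Section StrictSeparation.
Variables (R : realType) (T : finType) (px py : T -> R).
Hypothesis nc : noncollinear px py.
Hypothesis inj : forall i j, px i = px j -> py i = py j -> i = j.

Lemma perturb_sign (F G : T -> R) : exists2 e, 0 < e &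
  forall i, (F i < 0 -> F i + e * G i < 0) /\ (0 < F i -> 0 < F i + e * G i).
Proof.
pose g (k : T + T) : R * R * R :=
  match k with inl i => (F i, G i, 0) | inr i => (- F i, - G i, 0) end.
have [r r0 Hr] := aff_pos_stable g (0, 0).
exists (r / 2); first by rewrite divr_gt0.
have H k : 0 < aff (g k) (0, 0) -> 0 < aff (g k) (r / 2, 0).
  apply: Hr; rewrite /= subr0 ?normr0 // gtr0_norm ?divr_gt0 //; lra.
move=> i; split=> h.
  by have := H (inr i); rewrite /aff /= => /(_ ltac:(lra)); lra.
by have := H (inl i); rewrite /aff /= => /(_ ltac:(lra)); lra.
Qed.

(** If both sets touch the separating line, each does so in a single point, [s] and [t]. A slight
    turn of the direction towards [t - s] separates these two and keeps all strict inequalities. *)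
Lemma separated_strict (S S' : {set T}) : separated px py S S' ->
  exists d c, (forall i, i \in S -> lin px py d i < c) /\
    (forall i, i \in S' -> c < lin px py d i).
Proof.
move=> /andP[dis /boolp.asboolP [d d0 dS]].
have [S0|[i0 i0S]] := set_0Vmem S.
  exists (0, 0), (- 1); split=> i; first by rewrite S0 inE.
  by rewrite /lin /= !mul0r addr0 ltrN10.
have [s sS smax] := arg_maxP (lin px py d) i0S.
set c := lin px py d s.
have leS i : i \in S -> lin px py d i <= c by move=> iS; apply: smax.
have geS i : i \in S' -> c <= lin px py d i by move=> iS'; apply: dS.
suff [g [k [gS gS']]] : exists g k,
    (forall i, i \in S -> lin px py d i = c -> lin px py g i < k) /\
    (forall i, i \in S' -> lin px py d i = c -> k < lin px py g i).
  have [e e0 He] := perturb_sign (fun i => lin px py d i - c) (fun i => lin px py g i - k).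
  exists (d.1 + e * g.1, d.2 + e * g.2), (c + e * k).
  have E i : lin px py (d.1 + e * g.1, d.2 + e * g.2) i - (c + e * k) =
      (lin px py d i - c) + e * (lin px py g i - k).
    by rewrite /lin /=; ring.
  split=> i iS.
    rewrite -subr_lt0 E; have [h|h] := eqVneq (lin px py d i) c.
      by rewrite h subrr add0r pmulr_rlt0 // subr_lt0 gS.
    by apply: (He i).1; rewrite subr_lt0 lt_neqAle h leS.
  rewrite -subr_gt0 E; have [h|h] := eqVneq (lin px py d i) c.
    by rewrite h subrr add0r mulr_gt0 // subr_gt0 gS'.
  by apply: (He i).2; rewrite subr_gt0 lt_neqAle eq_sym h geS.
have [[t [tS' tc]]|not] := boolp.pselect (exists t, t \in S' /\ lin px py d t = c); last first.
  (* Only [S] touches the line, so a slight shift is enough. *)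
  exists (0, 0), 1; split=> i iS h; first by rewrite /lin /= !mul0r addr0 ltr01.
  by case: not; exists i.
have st : s != t by apply: contraTneq tS' => <-; rewrite (disjointFr dis sS).
have uS i : i \in S -> lin px py d i = c -> i = s.
  move=> iS h; apply/eqP; apply: contraT => ne.
  have it : i != t by apply: contraTneq tS' => <-; rewrite (disjointFr dis iS).
  by case: (line_lt3 nc d0 h (erefl c) tc ne it st).
have uS' i : i \in S' -> lin px py d i = c -> i = t.
  move=> iS h; apply/eqP; apply: contraT => ne.
  have it : i != s by apply: contraTneq iS => ->; rewrite (disjointFr dis sS).
  by case: (line_lt3 nc d0 h tc (erefl c) ne it); rewrite eq_sym.
pose g := (px t - px s, py t - py s).
have gst : 0 < lin px py g t - lin px py g s.
  rewrite (_ : _ - _ = (px t - px s) ^+ 2 + (py t - py s) ^+ 2); last first.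
    by rewrite /lin /g /=; ring.
  rewrite lt_neqAle addr_ge0 ?sqr_ge0 // andbT eq_sym paddr_eq0 ?sqr_ge0 //.
  rewrite !sqrf_eq0 !subr_eq0; apply/negP => /andP[/eqP h1 /eqP h2].
  by move/eqP: st; apply; apply: inj.
exists g, ((lin px py g s + lin px py g t) / 2); split=> i iS h.
  by rewrite (uS _ iS h); lra.
by rewrite (uS' _ iS h); lra.
Qed.

End StrictSeparation.

(** * Convex hulls and islands *)

Require Import Defs.
From mathcomp Require Import finmap.
From mathcomp Require Import all_classical all_reals convex.
From mathcomp Require Import interval_inference unstable.

Section Translation.
Variables (R : realType) (X : {fset 'rV[R]_2}).

Definition abscissa (x : X) : R := val x ord0 0.
Definition ordinate (x : X) : R := val x ord0 1.
Local Notation px := abscissa.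
Local Notation py := ordinate.

Lemma point_eq (u v : 'rV[R]_2) : u ord0 0 = v ord0 0 -> u ord0 1 = v ord0 1 -> u = v.
Proof.
move=> h0 h1; apply/rowP => i.
case: (unliftP 0 i) => [j ->|->] //; rewrite !ord1.
by move: h1; congr (_ = _); congr (_ _ _); apply: val_inj.
Qed.

Lemma perm_fset3 (p q r : 'rV[R]_2) : p != q -> p != r -> q != r ->
  perm_eq [fset p; q; r]%fset [:: p; q; r].
Proof.
move=> pq pr qr; apply: uniq_perm; first exact: fset_uniq.
  by rewrite /= !inE negb_or pq pr qr.
by move=> y; rewrite !inE orbA.
Qed.

Lemma affinely_independent3 (p q r : 'rV[R]_2) (a b c : R) :
  p != q -> p != r -> q != r -> affinely_independent [fset p; q; r]%fset ->
  a + b + c = 0 -> a *: p + b *: q + c *: r = 0 -> c = 0.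
Proof.
move=> pq pr qr ind s0 l0.
pose w y := if y == p then a else if y == q then b else c.
have perm := perm_fset3 pq pr qr.
have wp : w p = a by rewrite /w eqxx.
have wq : w q = b by rewrite /w eqxx eq_sym (negbTE pq).
have wr : w r = c by rewrite /w eq_sym (negbTE pr) eq_sym (negbTE qr).
rewrite -wr; apply: ind; rewrite ?(perm_big _ perm) /= ?big_cons ?big_nil ?wp ?wq ?wr.
- by rewrite addr0 addrA.
- by rewrite addr0 addrA.
- by rewrite !inE eqxx orbT.
Qed.

Lemma general_position_noncollinear : general_position X -> noncollinear px py.
Proof.
move=> gp i j k ij ik jk; apply/negP => /eqP d0.
have neq (x y : X) : x != y -> val x != val y by apply: contra_neq; apply: val_inj.
have ind : affinely_independent [fset val i; val j; val k]%fset.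
  apply: gp; last by rewrite (perm_size (perm_fset3 (neq _ _ ij) (neq _ _ ik) (neq _ _ jk))).
  by apply/fsubsetP => x; rewrite !inE => /orP[/orP[]|] /eqP ->; apply: valP.
have H a b c := @affinely_independent3 _ _ _ a b c (neq _ _ ij) (neq _ _ ik) (neq _ _ jk) ind.
have dE : (px j - px i) * (py k - py i) = (py j - py i) * (px k - px i).
  by apply/eqP; rewrite -subr_eq0; apply/eqP.
move/eqP: ij; apply; apply: val_inj; apply/esym; apply: point_eq.
- suff : - (px j - px i) = 0 by rewrite /abscissa; lra.
  (* Differences of abscissae are the coefficients of an affine dependency when [det] vanishes;
     independence gives equal abscissae, and the same with ordinates makes the points equal. *)
  apply: (H (px j - px k) (px k - px i)); first by ring.
  by apply: point_eq; rewrite !mxE; move: (dE); rewrite /abscissa /ordinate => dE'; lra.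
- suff : - (py j - py i) = 0 by rewrite /ordinate; lra.
  apply: (H (py j - py k) (py k - py i)); first by ring.
  by apply: point_eq; rewrite !mxE; move: (dE); rewrite /abscissa /ordinate => dE'; lra.
Qed.

Lemma hull_subset_halfplane (Y : {fset 'rV[R]_2}) (a b c : R) :
  (forall y, y \in Y -> a * y ord0 0 + b * y ord0 1 < c) ->
  (convex_hull Y `<=` [set y | (a * y ord0 0 + b * y ord0 1 < c)%R])%classic.
Proof.
move=> H; apply: smallest_sub; last by move=> y /=; apply: H.
move=> x y t; rewrite !in_setE /= => hx hy.
have t0 : 0 <= t%:num by [].
have t1 : t%:num <= 1 by [].
rewrite !mxE /= /onem.
rewrite (_ : a * _ + _ = t%:num * (a * x ord0 0 + b * x ord0 1)
   + (1 - t%:num) * (a * y ord0 0 + b * y ord0 1)); last by ring.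
have [->|tn0] := eqVneq t%:num 0; first by rewrite mul0r add0r subr0 mul1r.
have : 0 < t%:num by rewrite lt_neqAle eq_sym tn0.
nra.
Qed.

Section Hulls.
Hypothesis gp : general_position X.

Lemma separated_hulls (S S' : {set X}) : separated px py S S' ->
  (convex_hull [fsetval i in S]%fset `&` convex_hull [fsetval i in S']%fset = set0)%classic.
Proof.
have inj i j : px i = px j -> py i = py j -> i = j.
  by move=> h0 h1; apply: val_inj; apply: point_eq.
move=> /(separated_strict (general_position_noncollinear gp) inj) [d [c [H H']]].
rewrite -subset0 => y [].
have hS : forall y, y \in [fsetval i in S]%fset -> d.1 * y ord0 0 + d.2 * y ord0 1 < c.
  by move=> _ /imfsetP [i /= iS ->]; apply: H.
have hS' : forall y, y \in [fsetval i in S']%fset -> - d.1 * y ord0 0 + - d.2 * y ord0 1 < - c.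
  by move=> _ /imfsetP [i /= iS ->]; have := H' i iS; rewrite /lin /abscissa /ordinate; lra.
move=> /(hull_subset_halfplane hS) /= h1 /(hull_subset_halfplane hS') /= h2.
lra.
Qed.

End Hulls.
End Translation.

Lemma partition_color (R : realType) m (X : {fset 'rV[R]_2}) (C : 'I_m -> {fset 'rV[R]_2}) :
  partitions C X ->
  exists col : X -> 'I_m, forall x c, (val x \in C c) = (col x == c).
Proof.
move=> [dC XC]; have ex (x : X) : exists c, val x \in C c.
  have : val x \in (\bigcup_(i in 'I_m) C i)%fset by rewrite -XC; apply: valP.
  by move=> /bigfcupP [c _ xc]; exists c.
have [col colP] := boolp.choice ex; exists col => x c.
apply/idP/eqP => [xc|<- //]; apply/eqP; apply: contraT => ne.
by have /fdisjointP /(_ _ (colP x)) := dC _ _ ne; rewrite xc.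
Qed.

Lemma colorful_polychromatic (R : realType) m (X : {fset 'rV[R]_2})
    (C : 'I_m -> {fset 'rV[R]_2}) (col : X -> 'I_m) (Y : {fset 'rV[R]_2}) :
  (forall x c, (val x \in C c) = (col x == c)) -> (Y `<=` X)%fset ->
  colorful C 2 Y <-> polychromatic col (fsub X Y).
Proof.
move=> colP YX; split.
  move=> /card_gt1P [c [c' [+ + cc']]]; rewrite !inE.
  move=> /fset0Pn [x] /fsetIP [xC xY] /fset0Pn [y] /fsetIP [yC yY].
  exists [` fsubsetP YX _ xY]%fset, [` fsubsetP YX _ yY]%fset; rewrite !in_fsub; split=> //.
  move: (colP [` fsubsetP YX _ xY]%fset c) (colP [` fsubsetP YX _ yY]%fset c').
  by rewrite /= xC yC => /esym /eqP -> /esym /eqP ->.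
move=> [x [y []]]; rewrite !in_fsub => xY yY xy; apply/card_gt1P.
exists (col x), (col y); rewrite !inE; split=> //; apply/fset0Pn.
  by exists (val x); rewrite inE xY colP eqxx.
by exists (val y); rewrite inE yY colP eqxx.
Qed.

Theorem mainTheorem3 (R : realType) (k m n : nat)
    (hk : (2 <= k)%N) (hm : (2 <= m)%N) (hn : (1 <= n)%N)
    (X : {fset 'rV[R]_2}) (C : 'I_m -> {fset 'rV[R]_2})
    (hC : partitions C X) (hX : #|` X|%fset = (k * n)%N)
    (hgp : general_position X)
    (htuples : exists T : 'I_n -> {fset 'rV[R]_2},
       partitions T X /\
       forall i : 'I_n, #|` T i|%fset = k /\ colorful C 2 (T i)) :
  exists Y : 'I_n -> {fset 'rV[R]_2},
    (forall i : 'I_n, kisland k X (Y i) /\ colorful C 2 (Y i)) /\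
    (forall i j : 'I_n, i != j -> (convex_hull (Y i) `&` convex_hull (Y j) = set0)%classic).
Proof.
have [col colP] := partition_color hC.
have [T [partT hT]] := htuples; have [tup tupP] := partition_color partT.
have TX i : (T i `<=` X)%fset.
  have [_ ->] := partT; exact: bigfcup_sup.
have cX : #|[set: X]| = (k * n)%N by rewrite cardsT -cardfE.
have small : forall c, (#|[set: X] :&: colored col c| + n <= k * n)%N.
  apply: (@card_color_class _ _ n k col (fun i => fsub X (T i))).
  - by move=> x; exists (tup x); rewrite in_fsub tupP eqxx.
  - by move=> i; rewrite card_fsub //; have [] := hT i.
  - by move=> i; apply/(colorful_polychromatic colP (TX i)); have [] := hT i.
have nc := general_position_noncollinear hgp.
have [s [sn sep] hs] := polychromatic_parts nc hk cX small.
pose F (i : 'I_n) := nth finset.set0 s i.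
have Fs i : F i \in s by rewrite mem_nth // sn.
have sepF (i j : 'I_n) : (i < j)%N -> separated (@abscissa _ X) (@ordinate _ X) (F i) (F j).
  move=> ij; apply: (pairwiseP finset.set0 sep) => //; by rewrite inE sn.
pose Y (i : 'I_n) := [fsetval x in F i]%fset.
have hullF (i j : 'I_n) : i != j -> (convex_hull (Y i) `&` convex_hull (Y j) = set0)%classic.
  rewrite -val_eqE neq_ltn => /orP[ij|ij].
    exact: separated_hulls hgp _ _ (sepF _ _ ij).
  by rewrite setIC; apply: separated_hulls hgp _ _ (sepF _ _ ij).
have YX i : (Y i `<=` X)%fset by apply/fsubsetP => _ /imfsetP [x _ ->]; apply: valP.
(* The parts are disjoint, and their sizes add up to that of [X]. *)
have cover : forall x : X, exists i, x \in F i.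
  apply: (@disjoint_cover _ n k).
  - by move=> i; have [] := hs _ (Fs i).
  - move=> i j; rewrite -val_eqE neq_ltn => /orP[] /sepF /andP[] //.
    by rewrite disjoint_sym.
  - by rewrite -cardsT.
have subY i : (([set` Y i] : set 'rV[R]_2) `<=` convex_hull (Y i))%classic by apply: sub_smallest.
exists Y; split=> // i; split; last first.
  apply/(colorful_polychromatic colP (YX i)); rewrite FSetK.
  by have [] := hs _ (Fs i).
split; last by rewrite -(card_fsub (YX i)) FSetK; have [] := hs _ (Fs i).
split=> //; apply/seteqP; split=> [x [/= xX xh]|x xY]; last first.
  by split; [apply: (fsubsetP (YX i)) | apply: subY].
(* A point of [X] in the hull of [Y i] lies in some [Y j]; disjointness of hulls gives [j = i], so
   [Y i] spans an island. *)
have [j xj] := cover [` xX]%fset.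
have xYj : x \in Y j by apply/imfsetP; exists [` xX]%fset.
have [<- //|ij] := eqVneq j i.
have /seteqP [/(_ x) h _] := hullF _ _ ij.
by case: h; split=> //; apply: subY.
Qed.
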